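(* Let $A(x)=1+\sum_{n\ge1}a_nx^n$ and $y(x)=\sum_{n\ge1}y_nx^n$ be power series over $\mathbb{R}$ with radii of convergence $R$ and $r$, respectively. Assume that $R>0$, that $a_n\ge0$ for all $n\ge1$, that $y(x)=xA(y(x))$ as formal power series, and that $\gcd(\{n\ge1:a_n>0\})=1$. Then exactly one of the following is true: (1) $A(z)-zA'(z)$ is non-vanishing for $z\in(0,R)$, and $y(r)=R$. (2) $A(z)-zA'(z)$ vanishes at $z=y(r)$, and $y(r)<R$. Moreover, $z=y(r)$ is the unique solution to $A(z)-zA'(z)=0$ on $(0,R)$, and $y_n=Cr^{-n}n^{-3/2}(1+o(1))$ as $n\to\infty$, for some constant $C>0$.
   Context: Under these hypotheses $y_n\ge0$ for all $n$ and $r>0$; $y(r)$ denotes $\sum_{n\ge1}y_nr^n\in(0,\infty]$, and $R,r$ take values in $[0,\infty]$. *)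

(* Defs.v *)
From Stdlib Require Import Reals Arith.
From Coquelicot Require Import Coquelicot.
Open Scope R_scope.

(* A formal power series over R is its sequence of coefficients, as in
   Coquelicot's PS_mult, PS_incr_1 (multiplication by x), CV_radius, PSeries. *)

Definition PS_one : nat -> R := fun n => match n with O => 1 | S _ => 0 end.

Fixpoint PS_pow (y : nat -> R) (k : nat) : nat -> R :=
  match k with
  | O => PS_one
  | S k' => PS_mult y (PS_pow y k')
  end.

(* Formal composition a(y(x)), meaningful when y 0 = 0: then the coefficient of
   x^n in y^k is 0 for k > n, so that the sum over all k stops at k = n. *)
Definition PS_comp (a y : nat -> R) : nat -> R :=
  fun n => sum_n (fun k => a k * PS_pow y k n) n.

(* For S empty or S = {0} the gcd is 0. *)
Definition is_set_gcd (S : nat -> Prop) (g : nat) : Prop :=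
  (forall n, S n -> Nat.divide g n) /\
  (forall d, (forall n, S n -> Nat.divide d n) -> Nat.divide d g).

Fixpoint Rbar_pow (x : Rbar) (n : nat) : Rbar :=
  match n with
  | O => Finite 1
  | S n' => Rbar_mult x (Rbar_pow x n')
  end.

Fixpoint Rbar_partial_sum (u : nat -> Rbar) (N : nat) : Rbar :=
  match N with
  | O => Finite 0
  | S N' => Rbar_plus (Rbar_partial_sum u N') (u (S N'))
  end.

(* The sum over n >= 1 of y_n x^n in [0, +oo], for y_n >= 0 and x in [0, +oo]:
   the terms are nonnegative, so the sum is the supremum of the partial sums.
   Rbar_mult has the convention 0 * oo = 0. *)
Definition PS_value (y : nat -> R) (x : Rbar) : Rbar :=
  Rbar_lub (fun v => exists N : nat,
    v = Rbar_partial_sum (fun n => Rbar_mult (Finite (y n)) (Rbar_pow x n)) N).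

(* A(z) - z A'(z) for A(z) = sum of a_n z^n. *)
Definition char_fun (a : nat -> R) (z : R) : R :=
  PSeries a z - z * Derive (PSeries a) z.

(* Main.v *)
Require Import Defs.
From Stdlib Require Import Reals ZArith Lra Lia Classical Ranalysis5.
From Coquelicot Require Import Coquelicot.
Open Scope R_scope.

(** The equation y = x A(y) says that y inverts psi(z) = z / A(z), and the sign of psi'(z)
    is that of A(z) - z A'(z). Everything about the radius r and the value y(r) follows
    from nonnegativity of the coefficients. On one side, the partial sums of y(x) are
    dominated by the iteration Y -> x A(Y), so y(psi(z)) <= z for all z in (0, R)
    ([psi_iteration]). On the other, for 0 < x < r one has y(x) < R and psi(y(x)) = x
    ([value_fixpoint]).

    If A(z) - z A'(z) has no zero on (0, R), it is positive there, psi is strictly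
    increasing, y(psi(z)) = z for all z < R, and y(r) = R follows
    ([PS_value_nonvanishing]). If it has a zero z0, then the tangent to A at z0 passes
    through the origin, so psi is maximal at z0 by convexity of A; hence r = psi(z0) and
    y(r) = z0 < R ([radius_at_zero], [PS_value_at_zero]). The zero is unique because
    1 - (A(z) - z A'(z)) is a series with nonnegative coefficients without constant and
    linear term.

    The asymptotics come from Lagrange inversion, n y_n = [u^(n-1)] A(u)^n, proved by
    induction on n ([lagrange_inversion]). At the zero z0, the numbers
    p_k = a_k z0^k / A(z0) form a probability distribution of mean 1, and
    [u^(n-1)] A(u)^n = A(z0)^n z0^(1-n) P(S_n = n - 1), where S_n is a sum of n independent
    variables of law p. The local limit theorem ([local_limit]) says that
    sqrt(n) P(S_n = n - 1) has a positive limit. It is obtained from the Fourier integral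
    of the n-th power of the characteristic function, compared with a Gaussian: near 0 by
    a Taylor expansion of third order, and on the whole of [-pi, pi] by the bound
    exp(-c t^2) on the modulus, which is where the gcd hypothesis enters
    ([Cmod_charfn_gaussian]). *)

(* Goals over the carrier of one of the algebraic structures on R are restated as
   equations in R, which ring and field recognise. *)
Ltac R_eq := match goal with |- ?x = ?y => change (@eq R x y) end.

(** * Formal power series and Lagrange inversion *)

Lemma sum_triangle_swap (g : nat -> nat -> R) (n : nat) :
  sum_f_R0 (fun i => sum_f_R0 (g i) i) n =
  sum_f_R0 (fun k => sum_f_R0 (fun i => g (i + k)%nat k) (n - k)) n.
Proof.
  induction n as [|n IH]; [reflexivity|].
  simpl sum_f_R0 at 1. rewrite IH.
  rewrite (tech5 (fun k => sum_f_R0 (fun i => g (i + k)%nat k) (S n - k)) n).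
  rewrite Nat.sub_diag. simpl (sum_f_R0 _ 0).
  rewrite (sum_eq (fun k => sum_f_R0 (fun i => g (i + k)%nat k) (S n - k))
    (fun k => sum_f_R0 (fun i => g (i + k)%nat k) (n - k) + g (S n) k)).
  - rewrite sum_plus. ring.
  - intros k Hk. replace (S n - k)%nat with (S (n - k)) by lia.
    simpl. do 2 f_equal. lia.
Qed.

Lemma sum_reverse (f : nat -> R) (n : nat) :
  sum_f_R0 f n = sum_f_R0 (fun k => f (n - k)%nat) n.
Proof.
  revert f. induction n as [|n IH]; intros f; [reflexivity|].
  rewrite (decomp_sum f (S n)) by lia. simpl pred.
  rewrite (tech5 (fun k => f (S n - k)%nat) n).
  rewrite (IH (fun i => f (S i))), Nat.sub_diag, Rplus_comm. f_equal.
  apply sum_eq. intros k Hk. f_equal. lia.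
Qed.

Lemma PS_mult_ext (a a' b b' : nat -> R) (n : nat) :
  (forall k, (k <= n)%nat -> a k = a' k) ->
  (forall k, (k <= n)%nat -> b k = b' k) ->
  PS_mult a b n = PS_mult a' b' n.
Proof.
  intros Ha Hb. apply sum_eq. intros k Hk. rewrite Ha, Hb by lia. reflexivity.
Qed.

Lemma PS_mult_comm (a b : nat -> R) (n : nat) : PS_mult a b n = PS_mult b a n.
Proof.
  unfold PS_mult. rewrite sum_reverse. apply sum_eq. intros k Hk.
  replace (n - (n - k))%nat with k by lia. ring.
Qed.

Lemma PS_mult_assoc (a b c : nat -> R) (n : nat) :
  PS_mult (PS_mult a b) c n = PS_mult a (PS_mult b c) n.
Proof.
  unfold PS_mult.
  rewrite (sum_eq _ (fun i => sum_f_R0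
    (fun k => a k * b (i - k)%nat * c (n - i)%nat) i)).
  2:{ intros i _. rewrite Rmult_comm, scal_sum. reflexivity. }
  rewrite (sum_triangle_swap (fun i k => a k * b (i - k)%nat * c (n - i)%nat)).
  apply sum_eq. intros k Hk. rewrite scal_sum. apply sum_eq. intros i Hi.
  replace (i + k - k)%nat with i by lia.
  replace (n - (i + k))%nat with (n - k - i)%nat by lia. ring.
Qed.

Lemma PS_mult_one_l (a : nat -> R) (n : nat) : PS_mult PS_one a n = a n.
Proof.
  unfold PS_mult. destruct n as [|n]; [simpl; ring|].
  rewrite decomp_sum by lia. rewrite sum_eq_R0 by (intros; simpl; ring).
  simpl. ring.
Qed.

Lemma PS_mult_nonneg (a b : nat -> R) (n : nat) :
  (forall k, (k <= n)%nat -> 0 <= a k) -> (forall k, (k <= n)%nat -> 0 <= b k) ->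
  0 <= PS_mult a b n.
Proof.
  intros Ha Hb.
  unfold PS_mult. assert (H : forall m, (m <= n)%nat ->
    0 <= sum_f_R0 (fun k => a k * b (n - k)%nat) m).
  { induction m as [|m IH]; intros Hm; simpl.
    - apply Rmult_le_pos; [apply Ha | apply Hb]; lia.
    - apply Rplus_le_le_0_compat; [apply IH; lia|].
      apply Rmult_le_pos; [apply Ha | apply Hb]; lia. }
  apply H. lia.
Qed.

Lemma PS_pow_add (y : nat -> R) (i j n : nat) :
  PS_pow y (i + j) n = PS_mult (PS_pow y i) (PS_pow y j) n.
Proof.
  revert n. induction i as [|i IH]; intros n; simpl.
  - rewrite PS_mult_one_l. reflexivity.
  - rewrite PS_mult_assoc. apply PS_mult_ext; [reflexivity|]. intros; apply IH.
Qed.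

Lemma PS_pow_order (y : nat -> R) (k n : nat) :
  y 0%nat = 0 -> (n < k)%nat -> PS_pow y k n = 0.
Proof.
  intros Hy. revert n. induction k as [|k IH]; intros n Hn; [lia|].
  simpl. apply sum_eq_R0. intros [|i] Hi; [rewrite Hy; ring|].
  rewrite IH by lia. ring.
Qed.

Lemma PS_pow_nonneg (y : nat -> R) (N : nat) :
  (forall n, (n <= N)%nat -> 0 <= y n) ->
  forall k n, (n <= N)%nat -> 0 <= PS_pow y k n.
Proof.
  intros Hy. induction k as [|k IH]; intros n Hn; simpl.
  - destruct n; simpl; lra.
  - apply PS_mult_nonneg; intros; [apply Hy | apply IH]; lia.
Qed.

(** Used with c = 1 / A(z0), z = z0: tilting A into a probability generating function
    rescales the coefficients of its powers by explicit factors. *)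
Lemma PS_pow_dilate (a : nat -> R) (c z : R) (k n : nat) :
  PS_pow (fun i => a i * z ^ i * c) k n = PS_pow a k n * z ^ n * c ^ k.
Proof.
  revert n. induction k as [|k IH]; intros n; simpl PS_pow.
  - destruct n; simpl; ring.
  - unfold PS_mult. rewrite Rmult_assoc, Rmult_comm, scal_sum.
    apply sum_eq. intros i Hi. rewrite IH.
    replace (z ^ n) with (z ^ i * z ^ (n - i)) by (rewrite <- pow_add; f_equal; lia).
    simpl. ring.
Qed.

(** The operator x d/dx, a derivation of the ring of power series. *)
Definition PS_euler (f : nat -> R) : nat -> R := fun n => INR n * f n.

Lemma PS_euler_mult (f g : nat -> R) (n : nat) :
  PS_euler (PS_mult f g) n = PS_mult (PS_euler f) g n + PS_mult f (PS_euler g) n.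
Proof.
  unfold PS_euler, PS_mult. rewrite scal_sum, <- sum_plus. apply sum_eq.
  intros k Hk. rewrite minus_INR by lia. ring.
Qed.

Lemma PS_mult_scal_r (c : R) (f g : nat -> R) (n : nat) :
  PS_mult f (fun k => c * g k) n = c * PS_mult f g n.
Proof. unfold PS_mult. rewrite scal_sum. apply sum_eq. intros; ring. Qed.

Lemma PS_euler_pow (f : nat -> R) (k n : nat) :
  PS_euler (PS_pow f (S k)) n = INR (S k) * PS_mult (PS_euler f) (PS_pow f k) n.
Proof.
  revert n. induction k as [|k IH]; intros n.
  - change (PS_pow f 1) with (PS_mult f PS_one). rewrite PS_euler_mult.
    assert (H : PS_mult f (PS_euler PS_one) n = 0).
    { apply sum_eq_R0. intros i _. unfold PS_euler.
      destruct (n - i)%nat; simpl; ring. }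
    rewrite H. simpl. ring.
  - change (PS_pow f (S (S k))) with (PS_mult f (PS_pow f (S k))).
    rewrite PS_euler_mult.
    rewrite (PS_mult_ext f f (PS_euler (PS_pow f (S k)))
      (fun m => INR (S k) * PS_mult (PS_euler f) (PS_pow f k) m))
      by (intros; auto).
    rewrite PS_mult_scal_r, <- PS_mult_assoc.
    rewrite (PS_mult_ext (PS_mult f (PS_euler f)) (PS_mult (PS_euler f) f)
      (PS_pow f k) (PS_pow f k)) by (intros; auto using PS_mult_comm).
    rewrite PS_mult_assoc. change (PS_mult f (PS_pow f k)) with (PS_pow f (S k)).
    rewrite (S_INR (S k)). ring.
Qed.

Lemma PS_comp_upto (a y : nat -> R) (n N : nat) :
  y 0%nat = 0 -> (n <= N)%nat ->
  PS_comp a y n = sum_f_R0 (fun k => a k * PS_pow y k n) N.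
Proof.
  intros Hy HnN. unfold PS_comp. rewrite sum_n_Reals.
  induction HnN as [|N HnN IH]; [reflexivity|].
  rewrite IH, tech5, PS_pow_order by (auto; lia).
  rewrite Rmult_0_r, Rplus_0_r. reflexivity.
Qed.

Lemma PS_mult_sum_l (N : nat) (f : nat -> nat -> R) (c g : nat -> R) (n : nat) :
  PS_mult (fun i => sum_f_R0 (fun k => c k * f k i) N) g n =
  sum_f_R0 (fun k => c k * PS_mult (f k) g n) N.
Proof.
  induction N as [|N IH]; simpl.
  - symmetry. unfold PS_mult. rewrite scal_sum. apply sum_eq; intros; ring.
  - rewrite <- IH. unfold PS_mult. rewrite scal_sum, <- sum_plus.
    apply sum_eq; intros; ring.
Qed.

(** Multiply y = x A(y) by y^k and compare coefficients of x^(n+1). *)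
Lemma PS_pow_fixpoint (a y : nat -> R) (k n : nat) :
  y 0%nat = 0 -> (forall m, y m = PS_incr_1 (PS_comp a y) m) ->
  PS_pow y (S k) (S n) = sum_f_R0 (fun j => a j * PS_pow y (j + k) n) n.
Proof.
  intros Hy0 Hy. simpl PS_pow. unfold PS_mult at 1.
  rewrite decomp_sum by lia. rewrite Hy0, Rmult_0_l, Rplus_0_l. simpl pred.
  transitivity (PS_mult (fun i => sum_f_R0 (fun j => a j * PS_pow y j i) n)
    (PS_pow y k) n).
  - apply sum_eq. intros i Hi. rewrite <- PS_comp_upto by assumption.
    rewrite (Hy (S i)). simpl. reflexivity.
  - rewrite PS_mult_sum_l. apply sum_eq. intros j _. rewrite PS_pow_add.
    reflexivity.
Qed.

(** Lagrange's formula n [x^n] y^k = k [u^(n-k)] A^n by induction on n. Taking the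
    coefficient of x^(n+1) in y^(k+1) = x A(y) y^k gives a sum over j of
    a_j [x^n] y^(j+k), to which the induction hypothesis applies; it produces the
    factor j + k, and the part with j is resummed by the power rule
    x d/dx A^(n+1) = (n+1) (x A') A^n. *)
Lemma lagrange_inversion (a y : nat -> R) (n k : nat) :
  y 0%nat = 0 -> (forall m, y m = PS_incr_1 (PS_comp a y) m) ->
  (k <= n)%nat ->
  INR n * PS_pow y k n = INR k * PS_pow a n (n - k).
Proof.
  intros Hy0 Hy. revert k. induction n as [|n IH]; intros k Hk.
  - replace k with 0%nat by lia. simpl. ring.
  - destruct k as [|k].
    { simpl PS_pow at 1. simpl PS_one. simpl (INR 0). ring. }
    rewrite PS_pow_fixpoint with (a := a) by assumption.
    destruct n as [|n].
    { replace k with 0%nat by lia. simpl. unfold PS_mult; simpl. ring. }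
    (* the terms with j > m vanish, since y^(j+k) has no coefficient below x^(j+k) *)
    set (m := (S n - k)%nat).
    assert (Hm : (S (S n) - S k = m)%nat) by (unfold m; lia). rewrite Hm.
    assert (E : INR (S n) * sum_f_R0 (fun j => a j * PS_pow y (j + k) (S n)) (S n)
      = sum_f_R0 (fun j => INR (j + k) * a j * PS_pow a (S n) (m - j)) m).
    { rewrite scal_sum.
      assert (G : forall N, (m <= N)%nat -> (sum_f_R0
         (fun j => a j * PS_pow y (j + k) (S n) * INR (S n)) N =
         sum_f_R0 (fun j => INR (j + k) * a j * PS_pow a (S n) (m - j)) m)).
      { intros N HN. induction HN as [|N HN IHN].
        - apply sum_eq. intros j Hj.
          replace (a j * PS_pow y (j + k) (S n) * INR (S n)) with
            (a j * (INR (S n) * PS_pow y (j + k) (S n))) by ring.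
          rewrite IH by (unfold m in *; lia).
          replace (S n - (j + k))%nat with (m - j)%nat by (unfold m; lia). ring.
        - rewrite tech5, IHN, PS_pow_order by (auto; unfold m in *; lia). ring. }
      apply G. unfold m; lia. }
    pose proof (PS_euler_pow a (S n) m) as Eu. unfold PS_euler at 1 in Eu.
    assert (E2 : sum_f_R0 (fun j => INR (j + k) * a j * PS_pow a (S n) (m - j)) m
      = PS_mult (PS_euler a) (PS_pow a (S n)) m + INR k * PS_pow a (S (S n)) m).
    { change (PS_pow a (S (S n)) m) with (PS_mult a (PS_pow a (S n)) m).
      unfold PS_mult. rewrite scal_sum, <- sum_plus.
      apply sum_eq. intros j _. rewrite plus_INR. unfold PS_euler. ring. }
    rewrite E2 in E.
    assert (Hmr : INR m = INR (S n) - INR k) by (unfold m; apply minus_INR; lia).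
    rewrite Hmr in Eu.
    assert (Hn : 0 < INR (S n)) by (apply lt_0_INR; lia).
    rewrite (S_INR (S n)) in *. rewrite (S_INR k).
    set (X := sum_f_R0 _ _) in *. set (P := PS_pow a (S (S n)) m) in *.
    set (Q := PS_mult _ _ _) in *.
    apply Rmult_eq_reg_l with (INR (S n)); [|lra].
    replace (INR (S n) * ((INR (S n) + 1) * X)) with ((INR (S n) + 1) * (INR (S n) * X)) by ring.
    rewrite E. rewrite Rmult_plus_distr_l, <- Eu. ring.
Qed.

Lemma lagrange_inversion_1 (a y : nat -> R) (n : nat) :
  y 0%nat = 0 -> (forall m, y m = PS_incr_1 (PS_comp a y) m) ->
  INR (S n) * y (S n) = PS_pow a (S n) n.
Proof.
  intros Hy0 Hy.
  pose proof (lagrange_inversion a y (S n) 1 Hy0 Hy ltac:(lia)) as H.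
  simpl (PS_pow y 1) in H.
  rewrite PS_mult_comm, PS_mult_one_l in H.
  rewrite H. replace (S n - 1)%nat with n by lia. simpl (INR 1). ring.
Qed.

Lemma fixpoint_coef_nonneg (a y : nat -> R) :
  (forall n, 0 <= a n) -> y 0%nat = 0 ->
  (forall m, y m = PS_incr_1 (PS_comp a y) m) ->
  forall n, 0 <= y n.
Proof.
  intros Ha Hy0 Hy n.
  enough (H : forall m, (m <= n)%nat -> 0 <= y m) by (apply H; lia).
  induction n as [|n IH]; intros m Hm.
  - replace m with 0%nat by lia. lra.
  - destruct (Nat.eq_dec m (S n)) as [->|]; [|apply IH; lia].
    rewrite Hy. simpl. rewrite (PS_comp_upto a y n n) by (auto; lia).
    apply cond_pos_sum. intros k. apply Rmult_le_pos; [apply Ha|].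
    apply PS_pow_nonneg with n; auto.
Qed.

Lemma fixpoint_coef_1 (a y : nat -> R) :
  (forall m, y m = PS_incr_1 (PS_comp a y) m) -> y 1%nat = a 0%nat.
Proof. intros Hy. rewrite Hy. simpl. unfold PS_comp. rewrite sum_n_Reals. simpl. ring. Qed.

(** * The function A(z) - z A'(z) and the map z / A(z) *)

Lemma ex_series_term_le (u v : nat -> R) :
  (forall n, Rabs (u n) <= v n) -> ex_series v -> ex_series u.
Proof. intros H. apply (ex_series_le u v). exact H. Qed.

Lemma sum_nonneg_le_Series (u : nat -> R) (N : nat) :
  (forall n, 0 <= u n) -> ex_series u -> sum_f_R0 u N <= Series u.
Proof.
  intros Hu Hex. apply Series_correct in Hex.
  apply (is_lim_seq_incr_compare (sum_f_R0 u)).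
  - apply is_lim_seq_ext with (sum_n u); [intros; apply sum_n_Reals | exact Hex].
  - intros n. simpl. specialize (Hu (S n)). lra.
Qed.

Lemma Series_le_bound (u : nat -> R) (M : R) :
  (forall N, sum_f_R0 u N <= M) -> ex_series u -> Series u <= M.
Proof.
  intros H Hex. apply Series_correct in Hex.
  apply (is_lim_seq_le (sum_f_R0 u) (fun _ => M) (Series u) M H).
  - apply is_lim_seq_ext with (sum_n u); [intros; apply sum_n_Reals | exact Hex].
  - apply is_lim_seq_const.
Qed.

Lemma is_series_finite (u : nat -> R) (N : nat) :
  (forall n, (N < n)%nat -> u n = 0) -> is_series u (sum_f_R0 u N).
Proof.
  intros H. apply (is_lim_seq_ext_loc (fun _ => sum_f_R0 u N) (sum_n u)
    (sum_f_R0 u N)); [|apply is_lim_seq_const].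
  exists N. intros n Hn. rewrite sum_n_Reals.
  induction Hn as [|n Hn IH]; [reflexivity|].
  rewrite tech5, <- IH, H by lia. ring.
Qed.

Lemma is_series_le (u v : nat -> R) (l m : R) :
  (forall n, u n <= v n) -> is_series u l -> is_series v m -> l <= m.
Proof.
  intros H Hu Hv. apply (is_lim_seq_le (sum_n u) (sum_n v) l m); auto.
  intros n. apply sum_n_m_le, H.
Qed.

Lemma ex_series_inside (a : nat -> R) (x : R) :
  0 <= x -> Rbar_lt x (CV_radius a) -> ex_series (fun n => a n * x ^ n).
Proof.
  intros H0 Hx. apply ex_pseries_R, CV_radius_inside. rewrite Rabs_pos_eq; auto.
Qed.

Lemma is_series_PSeries (a : nat -> R) (x : R) :
  0 <= x -> Rbar_lt x (CV_radius a) -> is_series (fun n => a n * x ^ n) (PSeries a x).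
Proof. intros. apply Series_correct, ex_series_inside; auto. Qed.

Lemma CV_radius_ge_bounded (a : nat -> R) (x M : R) :
  (forall n, 0 <= a n) -> 0 <= x ->
  (forall N, sum_f_R0 (fun n => a n * x ^ n) N <= M) ->
  Rbar_le x (CV_radius a).
Proof.
  intros Ha Hx H. apply (proj1 (CV_radius_bounded a)). exists M. intros n.
  assert (T : forall k, 0 <= a k * x ^ k)
    by (intros; apply Rmult_le_pos; auto using pow_le).
  rewrite Rabs_pos_eq by apply T. eapply Rle_trans; [|apply (H n)].
  destruct n; simpl; [lra|].
  assert (0 <= sum_f_R0 (fun n => a n * x ^ n) n) by (apply cond_pos_sum; auto).
  simpl in H0. lra.
Qed.

Lemma CV_radius_euler (a : nat -> R) : CV_radius (PS_euler a) = CV_radius a.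
Proof.
  rewrite <- (CV_radius_derive a), <- (CV_radius_incr_1 (PS_derive a)).
  apply CV_radius_ext. intros [|n]; unfold PS_euler; simpl; [|reflexivity].
  change (@zero _) with 0. ring.
Qed.

Lemma char_fun_euler (a : nat -> R) (z : R) :
  0 <= z -> Rbar_lt z (CV_radius a) ->
  char_fun a z = PSeries a z - PSeries (PS_euler a) z.
Proof.
  intros H0 Hz. unfold char_fun.
  rewrite Derive_PSeries by (rewrite Rabs_pos_eq; auto).
  rewrite <- PSeries_incr_1. f_equal. apply PSeries_ext.
  intros [|n]; unfold PS_euler; simpl; [|reflexivity].
  change (@zero _) with 0. ring.
Qed.

(** Convexity of the n-th power, multiplied by w to avoid the exponent n - 1. *)
Lemma pow_tangent (z w : R) (n : nat) :
  0 <= z -> 0 <= w -> w * w ^ n + INR n * w ^ n * (z - w) <= w * z ^ n.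
Proof.
  intros Hz Hw. induction n as [|n IH]; [simpl; lra|].
  rewrite S_INR. simpl pow.
  apply Rle_trans with (z * (w * w ^ n + INR n * w ^ n * (z - w))).
  - assert (0 <= INR n * w ^ n * ((z - w) * (z - w))).
    { apply Rmult_le_pos; [apply Rmult_le_pos; auto using pos_INR, pow_le|].
      apply (Rle_0_sqr (z - w)). }
    nra.
  - apply Rle_trans with (z * (w * z ^ n)); [apply Rmult_le_compat_l; auto|].
    apply Req_le; ring.
Qed.

(** The graph of A lies above its tangent at w. Both the monotonicity and the maximum
    of z / A(z) are read off from this inequality, without differentiating a quotient. *)
Lemma PSeries_tangent (a : nat -> R) (z w : R) :
  (forall n, 0 <= a n) -> 0 <= z -> 0 <= w ->
  Rbar_lt z (CV_radius a) -> Rbar_lt w (CV_radius a) ->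
  w * PSeries a w + PSeries (PS_euler a) w * (z - w) <= w * PSeries a z.
Proof.
  intros Ha Hz Hw Hzr Hwr.
  pose proof (is_series_PSeries a z Hz Hzr) as Ez.
  pose proof (is_series_PSeries a w Hw Hwr) as Ew.
  assert (Hwr' : Rbar_lt w (CV_radius (PS_euler a))) by (rewrite CV_radius_euler; auto).
  pose proof (is_series_PSeries _ w Hw Hwr') as Ee.
  refine (is_series_le _ _ _ _ _ (is_series_plus _ _ _ _ (is_series_scal_l w _ _ Ew)
    (is_series_scal_r (z - w) _ _ Ee)) (is_series_scal_l w _ _ Ez)).
  intros n. change plus with Rplus. change scal with Rmult. unfold PS_euler.
  pose proof (pow_tangent z w n Hz Hw). specialize (Ha n). nra.
Qed.

(** For a_0 = 1, the coefficients of 1 - (A(z) - z A'(z)). The predecessor makes the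
    constant term 0, so all coefficients are nonnegative when those of A are. *)
Definition PS_defect (a : nat -> R) : nat -> R := fun n => INR (pred n) * a n.

Lemma is_series_defect (a : nat -> R) (z : R) :
  a 0%nat = 1 -> 0 <= z -> Rbar_lt z (CV_radius a) ->
  is_series (fun n => PS_defect a n * z ^ n) (1 - char_fun a z).
Proof.
  intros Ha0 Hz Hzr. rewrite char_fun_euler by assumption.
  pose proof (is_series_PSeries a z Hz Hzr) as Ez.
  assert (Hzr' : Rbar_lt z (CV_radius (PS_euler a))) by (rewrite CV_radius_euler; auto).
  pose proof (is_series_PSeries _ z Hz Hzr') as Ee.
  assert (E1 : is_series PS_one 1).
  { apply (is_series_finite PS_one 0). intros [|n] Hn; [lia | reflexivity]. }
  pose proof (is_series_plus _ _ _ _ (is_series_minus _ _ _ _ Ee Ez) E1) as H.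
  replace (1 - (PSeries a z - PSeries (PS_euler a) z)) with
    (PSeries (PS_euler a) z + - PSeries a z + 1) by ring.
  eapply is_series_ext; [|exact H]. intros n.
  change (PS_euler a n * z ^ n + - (a n * z ^ n) + PS_one n = PS_defect a n * z ^ n).
  unfold PS_defect, PS_euler. destruct n as [|n]; simpl PS_one; simpl pred.
  - rewrite Ha0. simpl. ring.
  - rewrite S_INR. ring.
Qed.

(** The series 1 - (A(z) - z A'(z)) has nonnegative coefficients and starts at z^2, so it
    grows at least linearly. *)
Lemma char_fun_scaling (a : nat -> R) (z w : R) :
  a 0%nat = 1 -> (forall n, 0 <= a n) -> 0 < z -> z <= w -> Rbar_lt w (CV_radius a) ->
  w * (1 - char_fun a z) <= z * (1 - char_fun a w).
Proof.
  intros Ha0 Ha Hz Hzw Hw.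
  assert (Hzr : Rbar_lt z (CV_radius a)) by (eapply Rbar_le_lt_trans; [|exact Hw]; exact Hzw).
  refine (is_series_le _ _ _ _ _
    (is_series_scal_l w _ _ (is_series_defect a z Ha0 ltac:(lra) Hzr))
    (is_series_scal_l z _ _ (is_series_defect a w Ha0 ltac:(lra) Hw))).
  intros n. change scal with Rmult. unfold PS_defect.
  destruct n as [|n]; [simpl; lra|].
  assert (0 <= INR (pred (S n)) * a (S n)) by (apply Rmult_le_pos; auto using pos_INR).
  assert (z ^ n <= w ^ n) by (apply pow_incr; lra).
  assert (0 <= z * w) by (apply Rmult_le_pos; lra).
  simpl pow.
  replace (w * (INR (pred (S n)) * a (S n) * (z * z ^ n))) with
    (INR (pred (S n)) * a (S n) * (z * w) * z ^ n) by ring.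
  replace (z * (INR (pred (S n)) * a (S n) * (w * w ^ n))) with
    (INR (pred (S n)) * a (S n) * (z * w) * w ^ n) by ring.
  apply Rmult_le_compat_l; [|assumption]. apply Rmult_le_pos; assumption.
Qed.

(** At a zero z0 the series 1 - (A(z) - z A'(z)) has the value 1, so by its linear growth
    it is below 1 on (0, z0). *)
Lemma char_fun_pos_before_zero (a : nat -> R) (z z0 : R) :
  a 0%nat = 1 -> (forall n, 0 <= a n) -> 0 < z < z0 -> Rbar_lt z0 (CV_radius a) ->
  char_fun a z0 = 0 -> 0 < char_fun a z.
Proof.
  intros Ha0 Ha Hz Hz0 H0.
  pose proof (char_fun_scaling a z z0 Ha0 Ha ltac:(lra) ltac:(lra) Hz0) as H.
  rewrite H0 in H. nra.
Qed.

Lemma char_fun_zero_unique (a : nat -> R) (z w : R) :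
  a 0%nat = 1 -> (forall n, 0 <= a n) ->
  0 < z -> Rbar_lt z (CV_radius a) -> char_fun a z = 0 ->
  0 < w -> Rbar_lt w (CV_radius a) -> char_fun a w = 0 -> z = w.
Proof.
  intros Ha0 Ha Hz Hzr H0z Hw Hwr H0w.
  destruct (Rtotal_order z w) as [H|[H|H]]; [exfalso|exact H|exfalso].
  - pose proof (char_fun_pos_before_zero a z w Ha0 Ha (conj Hz H) Hwr H0w). lra.
  - pose proof (char_fun_pos_before_zero a w z Ha0 Ha (conj Hw H) Hzr H0z). lra.
Qed.

Lemma PSeries_ge_1 (a : nat -> R) (z : R) :
  a 0%nat = 1 -> (forall n, 0 <= a n) -> 0 <= z -> Rbar_lt z (CV_radius a) ->
  1 <= PSeries a z.
Proof.
  intros Ha0 Ha Hz Hzr.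
  eapply Rle_trans; [|apply (sum_nonneg_le_Series (fun n => a n * z ^ n) 0)].
  - simpl. lra.
  - intros; apply Rmult_le_pos; auto using pow_le.
  - apply ex_series_inside; auto.
Qed.

(** The tangent at w, evaluated at z, gives
    w A(z) - z A(w) >= (w - z) (A(w) - w A'(w)). *)
Lemma psi_increasing (a : nat -> R) (z w : R) :
  a 0%nat = 1 -> (forall n, 0 <= a n) -> 0 < z < w -> Rbar_lt w (CV_radius a) ->
  0 < char_fun a w -> z / PSeries a z < w / PSeries a w.
Proof.
  intros Ha0 Ha [Hz Hzw] Hw Hc.
  assert (Hzr : Rbar_lt z (CV_radius a)) by (eapply Rbar_lt_trans; [|exact Hw]; exact Hzw).
  rewrite char_fun_euler in Hc by (auto; lra).
  pose proof (PSeries_tangent a z w Ha ltac:(lra) ltac:(lra) Hzr Hw) as H.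
  pose proof (PSeries_ge_1 a z Ha0 Ha ltac:(lra) Hzr).
  pose proof (PSeries_ge_1 a w Ha0 Ha ltac:(lra) Hw).
  apply Rmult_lt_reg_r with (PSeries a z * PSeries a w); [nra|].
  field_simplify; nra.
Qed.

(** At a zero z0 of A(z) - z A'(z), the tangent to A at z0 is the line through the
    origin with slope A(z0) / z0, and A lies above it. *)
Lemma psi_max (a : nat -> R) (z z0 : R) :
  a 0%nat = 1 -> (forall n, 0 <= a n) -> 0 < z0 -> Rbar_lt z0 (CV_radius a) ->
  char_fun a z0 = 0 -> 0 <= z -> Rbar_lt z (CV_radius a) ->
  z / PSeries a z <= z0 / PSeries a z0.
Proof.
  intros Ha0 Ha Hz0 Hr0 Hc Hz Hzr.
  rewrite char_fun_euler in Hc by (auto; lra).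
  pose proof (PSeries_tangent a z z0 Ha Hz ltac:(lra) Hzr Hr0) as H.
  pose proof (PSeries_ge_1 a z Ha0 Ha Hz Hzr).
  pose proof (PSeries_ge_1 a z0 Ha0 Ha ltac:(lra) Hr0).
  apply Rmult_le_reg_r with (PSeries a z * PSeries a z0); [nra|].
  field_simplify; nra.
Qed.

(** * Values of the solution y *)

Lemma sum_nonneg_incr (u : nat -> R) (n m : nat) :
  (forall k, 0 <= u k) -> (n <= m)%nat -> sum_f_R0 u n <= sum_f_R0 u m.
Proof.
  intros Hu H. induction H as [|m H IH]; [lra|]. simpl. specialize (Hu (S m)). lra.
Qed.

(** The Cauchy product collects the terms with p + q <= N, the product of the partial
    sums all those with p, q <= N. *)
Lemma partial_sum_mult_le (a b : nat -> R) (x : R) (N : nat) :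
  (forall n, 0 <= a n) -> (forall n, 0 <= b n) -> 0 <= x ->
  sum_f_R0 (fun n => PS_mult a b n * x ^ n) N <=
  sum_f_R0 (fun n => a n * x ^ n) N * sum_f_R0 (fun n => b n * x ^ n) N.
Proof.
  intros Ha Hb Hx. destruct N as [|N]; [simpl; unfold PS_mult; simpl; lra|].
  rewrite cauchy_finite by lia.
  set (rest := sum_f_R0 _ (pred (S N))).
  assert (0 <= rest).
  { apply cond_pos_sum. intros k. apply cond_pos_sum. intros l.
    repeat apply Rmult_le_pos; auto using pow_le. }
  apply Rle_trans with (sum_f_R0 (fun n => sum_f_R0
    (fun p => a p * x ^ p * (b (n - p)%nat * x ^ (n - p))) n) (S N)); [|lra].
  apply Req_le, sum_eq. intros n _. unfold PS_mult.
  rewrite Rmult_comm, scal_sum. apply sum_eq. intros p Hp.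
  replace (x ^ n) with (x ^ p * x ^ (n - p)) by (rewrite <- pow_add; f_equal; lia).
  ring.
Qed.

Lemma partial_sum_pow_le (y : nat -> R) (x : R) (N k : nat) :
  (forall n, 0 <= y n) -> 0 <= x ->
  sum_f_R0 (fun n => PS_pow y k n * x ^ n) N <=
  (sum_f_R0 (fun n => y n * x ^ n) N) ^ k.
Proof.
  intros Hy Hx. induction k as [|k IH].
  - simpl. destruct N as [|N]; [simpl; lra|].
    rewrite decomp_sum by lia. rewrite sum_eq_R0 by (intros; simpl; ring).
    simpl. lra.
  - simpl PS_pow. eapply Rle_trans.
    + apply partial_sum_mult_le; auto. intros n.
      apply PS_pow_nonneg with n; auto.
    + simpl pow. apply Rmult_le_compat_l; [|exact IH].
      apply cond_pos_sum. intros; apply Rmult_le_pos; auto using pow_le.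
Qed.

Lemma sum_swap (f : nat -> nat -> R) (n m : nat) :
  sum_f_R0 (fun i => sum_f_R0 (f i) m) n =
  sum_f_R0 (fun j => sum_f_R0 (fun i => f i j) n) m.
Proof.
  induction n as [|n IH]; [reflexivity|].
  rewrite tech5, IH, <- sum_plus. reflexivity.
Qed.

(** One step of the iteration Y -> x A(Y) produces at least one more coefficient of y. *)
Lemma partial_sum_step (a y : nat -> R) (x : R) (N : nat) :
  (forall n, 0 <= a n) -> (forall n, 0 <= y n) -> y 0%nat = 0 ->
  (forall m, y m = PS_incr_1 (PS_comp a y) m) -> 0 <= x ->
  sum_f_R0 (fun n => y n * x ^ n) (S N) <=
  x * sum_f_R0 (fun k => a k * (sum_f_R0 (fun n => y n * x ^ n) N) ^ k) N.
Proof.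
  intros Ha Hyn Hy0 Hy Hx.
  rewrite decomp_sum by lia. rewrite Hy0, Rmult_0_l, Rplus_0_l. simpl pred.
  rewrite (sum_eq _ (fun n => sum_f_R0 (fun k => a k * (PS_pow y k n * x ^ n)) N * x)).
  2:{ intros n Hn. rewrite (Hy (S n)).
      change (PS_incr_1 (PS_comp a y) (S n)) with (PS_comp a y n).
      rewrite (PS_comp_upto a y n N) by auto.
      rewrite (Rmult_comm _ (x ^ S n)), scal_sum, Rmult_comm, scal_sum.
      apply sum_eq. intros; simpl; ring. }
  rewrite <- scal_sum. apply Rmult_le_compat_l; [exact Hx|].
  rewrite sum_swap. apply sum_Rle. intros k _.
  rewrite (sum_eq _ (fun n => PS_pow y k n * x ^ n * a k)) by (intros; ring).
  rewrite <- scal_sum. apply Rmult_le_compat_l; [apply Ha|].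
  apply partial_sum_pow_le; auto.
Qed.

(** The iteration Y -> x A(Y) from 0 is increasing and stays below every z with
    x A(z) <= z; this bounds y(x) before its convergence is known. *)
Lemma partial_sum_le_fixpoint (a y : nat -> R) (x z : R) (N : nat) :
  (forall n, 0 <= a n) -> (forall n, 0 <= y n) -> y 0%nat = 0 ->
  (forall m, y m = PS_incr_1 (PS_comp a y) m) -> 0 <= x -> 0 <= z ->
  (forall M, x * sum_f_R0 (fun k => a k * z ^ k) M <= z) ->
  sum_f_R0 (fun n => y n * x ^ n) N <= z.
Proof.
  intros Ha Hyn Hy0 Hy Hx Hz H. induction N as [|N IH]; [simpl; lra|].
  eapply Rle_trans; [apply (partial_sum_step a y); auto|].
  eapply Rle_trans; [|apply (H N)]. apply Rmult_le_compat_l; [exact Hx|].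
  apply sum_Rle. intros k _. apply Rmult_le_compat_l; [apply Ha|].
  apply pow_incr. split; [|exact IH].
  apply cond_pos_sum. intros; apply Rmult_le_pos; auto using pow_le.
Qed.

Lemma is_series_PS_pow (y : nat -> R) (x : R) (k : nat) :
  (forall n, 0 <= y n) -> 0 <= x -> Rbar_lt x (CV_radius y) ->
  is_series (fun n => PS_pow y k n * x ^ n) (PSeries y x ^ k).
Proof.
  intros Hyn Hx Hr.
  pose proof (is_series_PSeries y x Hx Hr) as Hy.
  assert (Habs : forall (u : nat -> R) l, (forall n, 0 <= u n) ->
    is_series (fun n => u n * x ^ n) l -> ex_series (fun n => Rabs (u n * x ^ n))).
  { intros u l Hu Hl. exists l. apply (is_series_ext (fun n => u n * x ^ n)); auto.
    intros n. rewrite Rabs_pos_eq; auto. apply Rmult_le_pos; auto using pow_le. }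
  induction k as [|k IH].
  - replace (PSeries y x ^ 0) with (sum_f_R0 (fun n => PS_pow y 0 n * x ^ n) 0)
      by (simpl; ring).
    apply is_series_finite. intros [|n] Hn; [lia | simpl; ring].
  - eapply is_series_ext; [|apply (is_series_mult _ _ _ _ Hy IH)].
    + intros n. simpl PS_pow. unfold PS_mult. rewrite Rmult_comm, scal_sum.
      apply sum_eq. intros p Hp.
      replace (x ^ n) with (x ^ p * x ^ (n - p)) by (rewrite <- pow_add; f_equal; lia).
      ring.
    + apply (Habs y (PSeries y x)); auto.
    + apply (Habs (PS_pow y k) (PSeries y x ^ k)); auto.
      intros n. apply PS_pow_nonneg with n; auto.
Qed.

Lemma is_series_sum_f_R0 (f : nat -> nat -> R) (l : nat -> R) (K : nat) :
  (forall k, is_series (f k) (l k)) ->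
  is_series (fun n => sum_f_R0 (fun k => f k n) K) (sum_f_R0 l K).
Proof.
  intros H. induction K as [|K IH]; [apply H|].
  exact (is_series_plus _ _ _ _ IH (H (S K))).
Qed.

(** The converse of the iteration bound: x A_K(y(x)) is a sum of part of the terms of y(x). *)
Lemma scaled_partial_sum_le_value (a y : nat -> R) (x : R) (K : nat) :
  (forall n, 0 <= a n) -> (forall n, 0 <= y n) -> y 0%nat = 0 ->
  (forall m, y m = PS_incr_1 (PS_comp a y) m) ->
  0 <= x -> Rbar_lt x (CV_radius y) ->
  x * sum_f_R0 (fun k => a k * PSeries y x ^ k) K <= PSeries y x.
Proof.
  intros Ha Hyn Hy0 Hy Hx Hr.
  pose proof (is_series_PSeries y x Hx Hr) as HY.
  assert (HY' : is_series (fun n => y (S n) * x ^ S n) (PSeries y x)).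
  { apply (is_series_incr_1 (fun n => y n * x ^ n)).
    assert (E : PSeries y x + y 0%nat * x ^ 0 = PSeries y x) by (rewrite Hy0; ring).
    change (is_series (fun n => y n * x ^ n) (PSeries y x + y 0%nat * x ^ 0)).
    rewrite E. exact HY. }
  refine (is_series_le _ _ _ _ _ (is_series_scal_l x _ _
    (is_series_sum_f_R0 (fun k n => a k * (PS_pow y k n * x ^ n)) _ K
      (fun k => is_series_scal_l (a k) _ _ (is_series_PS_pow y x k Hyn Hx Hr)))) HY').
  intros n. change scal with Rmult. cbv beta.
  rewrite (Hy (S n)). change (PS_incr_1 (PS_comp a y) (S n)) with (PS_comp a y n).
  rewrite (PS_comp_upto a y n (Nat.max n K)) by (auto; lia).
  rewrite (Rmult_comm _ (x ^ S n)). simpl pow. rewrite Rmult_assoc.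
  apply Rmult_le_compat_l; [exact Hx|]. rewrite scal_sum.
  rewrite (sum_eq (fun k => a k * (PS_pow y k n * x ^ n))
    (fun k => a k * PS_pow y k n * x ^ n)) by (intros; ring).
  apply (sum_nonneg_incr (fun k => a k * PS_pow y k n * x ^ n)); [|lia].
  intros k. repeat apply Rmult_le_pos; auto using pow_le.
  apply PS_pow_nonneg with n; auto.
Qed.

Lemma value_ge_id (y : nat -> R) (x : R) :
  (forall n, 0 <= y n) -> y 1%nat = 1 -> 0 <= x -> Rbar_lt x (CV_radius y) ->
  x <= PSeries y x.
Proof.
  intros Hyn Hy1 Hx Hr.
  eapply Rle_trans; [|apply (sum_nonneg_le_Series (fun n => y n * x ^ n) 1)].
  - simpl. rewrite Hy1. specialize (Hyn 0%nat). lra.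
  - intros; apply Rmult_le_pos; auto using pow_le.
  - apply ex_series_inside; auto.
Qed.

Lemma value_increasing (y : nat -> R) (x x' : R) :
  (forall n, 0 <= y n) -> y 1%nat = 1 -> 0 <= x < x' -> Rbar_lt x' (CV_radius y) ->
  PSeries y x < PSeries y x'.
Proof.
  intros Hyn Hy1 [Hx Hxx] Hr.
  assert (Hr0 : Rbar_lt x (CV_radius y)) by (eapply Rbar_lt_trans; [|exact Hr]; exact Hxx).
  pose proof (is_series_minus _ _ _ _ (is_series_PSeries y x' ltac:(lra) Hr)
    (is_series_PSeries y x Hx Hr0)) as H.
  pose proof (is_series_finite (fun n => if Nat.eq_dec n 1 then x' - x else 0) 1) as H1.
  assert (x' - x <= PSeries y x' - PSeries y x); [|lra].
  replace (x' - x) with (sum_f_R0 (fun n => if Nat.eq_dec n 1 then x' - x else 0) 1)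
    by (simpl; ring).
  refine (is_series_le _ _ _ _ _ (H1 _) H).
  - intros n. change plus with Rplus. change opp with Ropp.
    assert (x ^ n <= x' ^ n) by (apply pow_incr; lra).
    specialize (Hyn n). destruct (Nat.eq_dec n 1) as [->|]; [rewrite Hy1; simpl; lra|].
    nra.
  - intros n Hn. destruct (Nat.eq_dec n 1); [lia | reflexivity].
Qed.

(** A(y(x)) converges, with sum at most y(x) / x. *)
Lemma value_le_radius (a y : nat -> R) (x : R) :
  (forall n, 0 <= a n) -> (forall n, 0 <= y n) -> y 0%nat = 0 -> y 1%nat = 1 ->
  (forall m, y m = PS_incr_1 (PS_comp a y) m) ->
  0 < x -> Rbar_lt x (CV_radius y) ->
  Rbar_le (PSeries y x) (CV_radius a).
Proof.
  intros Ha Hyn Hy0 Hy1 Hy Hx Hr.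
  pose proof (value_ge_id y x Hyn Hy1 ltac:(lra) Hr) as HY.
  apply CV_radius_ge_bounded with (PSeries y x / x); auto; [lra|].
  intros N. apply Rmult_le_reg_l with x; [exact Hx|].
  replace (x * (PSeries y x / x)) with (PSeries y x) by (field; lra).
  apply scaled_partial_sum_le_value; auto; lra.
Qed.

Lemma Rbar_dense (x : R) (b : Rbar) : Rbar_lt x b -> exists z : R, x < z /\ Rbar_lt z b.
Proof.
  destruct b as [b| |]; simpl; intros H.
  - exists ((x + b) / 2). lra.
  - exists (x + 1). lra.
  - contradiction.
Qed.

(** Strictly inside the disc of convergence y(x) < R, because y(x) < y(x') <= R for some
    larger x'; so A may be evaluated at y(x), and y(x) is a preimage of x under
    z / A(z). *)
Lemma value_fixpoint (a y : nat -> R) (x : R) :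
  a 0%nat = 1 ->
  (forall n, 0 <= a n) -> (forall n, 0 <= y n) -> y 0%nat = 0 -> y 1%nat = 1 ->
  (forall m, y m = PS_incr_1 (PS_comp a y) m) ->
  0 < x -> Rbar_lt x (CV_radius y) ->
  0 < PSeries y x /\ Rbar_lt (PSeries y x) (CV_radius a) /\
  PSeries y x / PSeries a (PSeries y x) = x.
Proof.
  intros Ha0 Ha Hyn Hy0 Hy1 Hy Hx Hr.
  pose proof (value_ge_id y x Hyn Hy1 ltac:(lra) Hr) as HY.
  assert (HR : Rbar_lt (PSeries y x) (CV_radius a)).
  { destruct (Rbar_dense x _ Hr) as (x' & Hxx & Hr').
    apply Rbar_lt_le_trans with (PSeries y x').
    - apply value_increasing; auto; lra.
    - apply value_le_radius; auto; lra. }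
  split; [lra|]. split; [exact HR|].
  assert (HA := PSeries_ge_1 a _ Ha0 Ha (Rle_trans _ _ _ (Rlt_le _ _ Hx) HY) HR).
  assert (E : x * PSeries a (PSeries y x) = PSeries y x).
  { apply Rle_antisym.
    - pose proof (ex_series_inside a (PSeries y x) ltac:(lra) HR) as Hex.
      apply Rmult_le_reg_l with (/ x); [apply Rinv_0_lt_compat; lra|].
      rewrite <- Rmult_assoc, Rinv_l, Rmult_1_l by lra.
      apply Series_le_bound; [|exact Hex].
      intros N. apply Rmult_le_reg_l with x; [exact Hx|].
      rewrite <- (Rmult_assoc x (/ x)), Rinv_r, Rmult_1_l by lra.
      apply scaled_partial_sum_le_value; auto; lra.
    - apply Series_le_bound; [|apply ex_series_inside; auto; lra].
      assert (Hpos : 0 <= x * PSeries a (PSeries y x)) by (apply Rmult_le_pos; lra).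
      intros [|N]; [simpl; rewrite Hy0; lra|].
      eapply Rle_trans; [apply (partial_sum_step a y); auto; lra|].
      apply Rmult_le_compat_l; [lra|].
      eapply Rle_trans; [|apply (sum_nonneg_le_Series
        (fun k => a k * PSeries y x ^ k) N)].
      + apply sum_Rle. intros k _. apply Rmult_le_compat_l; [apply Ha|].
        apply pow_incr. split.
        * apply cond_pos_sum. intros; apply Rmult_le_pos; auto. apply pow_le; lra.
        * apply (sum_nonneg_le_Series (fun n => y n * x ^ n)).
          -- intros; apply Rmult_le_pos; auto. apply pow_le; lra.
          -- apply ex_series_inside; auto; lra.
      + intros; apply Rmult_le_pos; auto. apply pow_le; lra.
      + apply ex_series_inside; auto; lra. }
  rewrite <- E at 1. field. lra.
Qed.

(** z itself is a fixed point of Y -> x A(Y) for x = z / A(z), so it dominates all the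
    partial sums of y(x), and x is at most the radius of y. *)
Lemma psi_iteration (a y : nat -> R) (z : R) :
  a 0%nat = 1 ->
  (forall n, 0 <= a n) -> (forall n, 0 <= y n) -> y 0%nat = 0 ->
  (forall m, y m = PS_incr_1 (PS_comp a y) m) ->
  0 < z -> Rbar_lt z (CV_radius a) ->
  0 < z / PSeries a z /\
  (forall N, sum_f_R0 (fun n => y n * (z / PSeries a z) ^ n) N <= z) /\
  Rbar_le (z / PSeries a z) (CV_radius y).
Proof.
  intros Ha0 Ha Hyn Hy0 Hy Hz Hzr.
  pose proof (PSeries_ge_1 a z Ha0 Ha ltac:(lra) Hzr) as HA.
  assert (Hx : 0 < z / PSeries a z) by (apply Rdiv_lt_0_compat; lra).
  assert (H : forall N, sum_f_R0 (fun n => y n * (z / PSeries a z) ^ n) N <= z).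
  { intros N. apply partial_sum_le_fixpoint with (a := a); auto; try lra.
    intros M. apply Rle_trans with (z / PSeries a z * PSeries a z).
    - apply Rmult_le_compat_l; [lra|].
      apply (sum_nonneg_le_Series (fun k => a k * z ^ k)).
      + intros; apply Rmult_le_pos; auto. apply pow_le; lra.
      + apply ex_series_inside; auto; lra.
    - apply Req_le. field. lra. }
  split; [exact Hx|]. split; [exact H|].
  apply CV_radius_ge_bounded with z; auto; lra.
Qed.

(** y(x) <= z for x = z / A(z), and both have image x under z / A(z), which is
    smaller on (0, z) than at z. The point z' only serves to place x strictly inside the disc. *)
Lemma value_psi (a y : nat -> R) (z z' : R) :
  a 0%nat = 1 ->
  (forall n, 0 <= a n) -> (forall n, 0 <= y n) -> y 0%nat = 0 -> y 1%nat = 1 ->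
  (forall m, y m = PS_incr_1 (PS_comp a y) m) ->
  0 < z < z' -> Rbar_lt z' (CV_radius a) ->
  0 < char_fun a z -> 0 < char_fun a z' ->
  Rbar_lt (z / PSeries a z) (CV_radius y) /\ PSeries y (z / PSeries a z) = z.
Proof.
  intros Ha0 Ha Hyn Hy0 Hy1 Hy Hz Hz' Hc Hc'.
  assert (Hzr : Rbar_lt z (CV_radius a))
    by (apply (Rbar_lt_trans z z'); [exact (proj2 Hz) | exact Hz']).
  destruct (psi_iteration a y z Ha0 Ha Hyn Hy0 Hy ltac:(lra) Hzr) as (Hx & Hb & _).
  destruct (psi_iteration a y z' Ha0 Ha Hyn Hy0 Hy ltac:(lra) Hz') as (_ & _ & Hr).
  pose proof (psi_increasing a z z' Ha0 Ha Hz Hz' Hc') as Hlt.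
  assert (Hxr : Rbar_lt (z / PSeries a z) (CV_radius y)).
  { eapply Rbar_lt_le_trans; [|exact Hr]. exact Hlt. }
  split; [exact Hxr|].
  destruct (value_fixpoint a y _ Ha0 Ha Hyn Hy0 Hy1 Hy Hx Hxr) as (HY & HYr & HE).
  assert (HYz : PSeries y (z / PSeries a z) <= z)
    by (apply Series_le_bound; [exact Hb | apply ex_series_inside; auto; lra]).
  destruct HYz as [HYz|]; [|assumption].
  pose proof (psi_increasing a _ z Ha0 Ha (conj HY HYz) Hzr Hc). lra.
Qed.

(** Every x inside the disc is a value of z / A(z), whose maximum is attained at z0; and
    that maximum is at most the radius. *)
Lemma radius_at_zero (a y : nat -> R) (z0 : R) :
  a 0%nat = 1 ->
  (forall n, 0 <= a n) -> (forall n, 0 <= y n) -> y 0%nat = 0 -> y 1%nat = 1 ->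
  (forall m, y m = PS_incr_1 (PS_comp a y) m) ->
  0 < z0 -> Rbar_lt z0 (CV_radius a) -> char_fun a z0 = 0 ->
  CV_radius y = z0 / PSeries a z0.
Proof.
  intros Ha0 Ha Hyn Hy0 Hy1 Hy Hz0 Hr Hc.
  destruct (psi_iteration a y z0 Ha0 Ha Hyn Hy0 Hy Hz0 Hr) as (Hx & _ & Hle).
  destruct (Rbar_le_lt_or_eq_dec _ _ Hle) as [Hlt|]; [exfalso|auto].
  destruct (Rbar_dense _ _ Hlt) as (x & Hxx & Hxr).
  destruct (value_fixpoint a y x Ha0 Ha Hyn Hy0 Hy1 Hy ltac:(lra) Hxr) as (HY & HYr & HE).
  pose proof (psi_max a (PSeries y x) z0 Ha0 Ha Hz0 Hr Hc ltac:(lra) HYr). lra.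
Qed.

Lemma PS_value_Finite_lub (y : nat -> R) (s : R) (b : Rbar) :
  y 0%nat = 0 ->
  Rbar_is_lub (fun v => exists N, v = Finite (sum_f_R0 (fun n => y n * s ^ n) N)) b ->
  PS_value y s = b.
Proof.
  intros Hy0 Hb. unfold PS_value. rewrite <- (Rbar_is_lub_unique _ _ Hb).
  apply Rbar_lub_rw. intros v.
  assert (E : forall N, Rbar_partial_sum
    (fun n => Rbar_mult (Finite (y n)) (Rbar_pow s n)) N =
    Finite (sum_f_R0 (fun n => y n * s ^ n) N)).
  { assert (P : forall n, Rbar_pow s n = Finite (s ^ n)).
    { induction n as [|n IH]; [reflexivity|]. simpl Rbar_pow. rewrite IH. reflexivity. }
    induction N as [|N IH].
    - simpl. rewrite Hy0. f_equal. ring.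
    - simpl Rbar_partial_sum. rewrite IH, (P N). reflexivity. }
  split; intros [N HN]; exists N; rewrite HN, E; reflexivity.
Qed.

Lemma PS_value_infinite (y : nat -> R) :
  y 1%nat = 1 -> PS_value y p_infty = p_infty.
Proof.
  intros Hy1. apply Rbar_is_lub_unique. split.
  - intros v _. destruct v; exact I.
  - intros b Hb. apply Hb. exists 1%nat. simpl Rbar_partial_sum.
    rewrite Hy1. unfold Rbar_pow, Rbar_mult, Rbar_mult'.
    destruct (Rle_dec 0 1) as [H|]; [|lra].
    destruct (Rle_lt_or_eq_dec 0 1 H); [|lra].
    destruct (Rle_dec 0 1) as [H'|]; [|lra].
    destruct (Rle_lt_or_eq_dec 0 1 H'); [reflexivity | lra].
Qed.

Lemma value_le_partial_ub (y : nat -> R) (x s : R) (b : Rbar) :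
  (forall n, 0 <= y n) -> 0 <= x <= s -> Rbar_lt x (CV_radius y) ->
  (forall N, Rbar_le (sum_f_R0 (fun n => y n * s ^ n) N) b) ->
  Rbar_le (PSeries y x) b.
Proof.
  intros Hyn Hx Hr Hb. destruct b as [b| |]; [|exact I|exact (Hb 0%nat)].
  apply Series_le_bound; [|apply ex_series_inside; auto; lra].
  intros N. eapply Rle_trans; [|exact (Hb N)]. apply sum_Rle. intros n _.
  apply Rmult_le_compat_l; [apply Hyn|]. apply pow_incr; lra.
Qed.

Lemma Rbar_le_of_dense (c b : Rbar) :
  Rbar_lt 0 c -> (forall z : R, 0 < z -> Rbar_lt z c -> Rbar_le z b) -> Rbar_le c b.
Proof.
  intros Hc H. apply Rbar_not_lt_le. intros Hbc.
  destruct b as [b| |].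
  - assert (Hm : Rbar_lt (Rmax 0 b) c) by (unfold Rmax; destruct Rle_dec; auto).
    destruct (Rbar_dense _ _ Hm) as (z & Hz & Hzc).
    pose proof (Rmax_l 0 b). pose proof (Rmax_r 0 b).
    specialize (H z ltac:(lra) Hzc). simpl in H. lra.
  - destruct c; exact Hbc.
  - destruct (Rbar_dense _ _ Hc) as (z & Hz & Hzc). exact (H z Hz Hzc).
Qed.

(** The partial sums at the radius are at most z0 by the iteration bound, and
    their supremum is at least y(z / A(z)) = z for every z < z0. *)
Lemma PS_value_at_zero (a y : nat -> R) (z0 : R) :
  a 0%nat = 1 ->
  (forall n, 0 <= a n) -> (forall n, 0 <= y n) -> y 0%nat = 0 -> y 1%nat = 1 ->
  (forall m, y m = PS_incr_1 (PS_comp a y) m) ->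
  0 < z0 -> Rbar_lt z0 (CV_radius a) -> char_fun a z0 = 0 ->
  PS_value y (z0 / PSeries a z0) = z0.
Proof.
  intros Ha0 Ha Hyn Hy0 Hy1 Hy Hz0 Hr Hc.
  destruct (psi_iteration a y z0 Ha0 Ha Hyn Hy0 Hy Hz0 Hr) as (Hx & Hb & Hle).
  apply PS_value_Finite_lub; [exact Hy0|]. split.
  - intros v [N ->]. apply Hb.
  - intros b Hub. apply Rbar_le_of_dense; [exact Hz0|]. intros z Hz Hzz. simpl in Hzz.
    set (z' := (z + z0) / 2).
    assert (Hz' : z < z' < z0) by (unfold z'; lra).
    assert (Hzr : forall w, w <= z0 -> Rbar_lt w (CV_radius a))
      by (intros w Hw; apply (Rbar_le_lt_trans w z0); [exact Hw | exact Hr]).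
    destruct (value_psi a y z z' Ha0 Ha Hyn Hy0 Hy1 Hy) as [Hxr HE]; try lra.
    + apply Hzr; lra.
    + apply (char_fun_pos_before_zero a z z0); auto; lra.
    + apply (char_fun_pos_before_zero a z' z0); auto; lra.
    + rewrite <- HE.
      apply value_le_partial_ub with (s := z0 / PSeries a z0); auto.
      * split; [|apply psi_max; auto; try lra; apply Hzr; lra].
        apply Rlt_le, (psi_iteration a y z Ha0 Ha Hyn Hy0 Hy); auto. apply Hzr; lra.
      * intros N. apply Hub. exists N. reflexivity.
Qed.

Lemma char_fun_pos_of_nonvanishing (a : nat -> R) (z : R) :
  a 0%nat = 1 -> (forall n, 0 <= a n) ->
  (forall w : R, 0 < w -> Rbar_lt w (CV_radius a) -> char_fun a w <> 0) ->
  0 < z -> Rbar_lt z (CV_radius a) -> 0 < char_fun a z.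
Proof.
  intros Ha0 Ha Hnz Hz Hr.
  destruct (Rtotal_order 0 (char_fun a z)) as [H|[H|H]]; [exact H| |].
  - symmetry in H. destruct (Hnz z Hz Hr H).
  - exfalso.
    assert (Hin : forall w, 0 <= w <= z -> Rbar_lt w (CV_radius a))
      by (intros w Hw; apply (Rbar_le_lt_trans w z); [apply Hw | exact Hr]).
    destruct (IVT_interv (fun w => PSeries (PS_euler a) w - PSeries a w) 0 z)
      as (w & Hw & Hw0).
    + intros w Hw. apply continuity_pt_minus; apply PSeries_continuity;
      rewrite Rabs_pos_eq by lra; [rewrite CV_radius_euler|]; apply Hin; lra.
    + exact Hz.
    + rewrite !PSeries_0. unfold PS_euler. rewrite Ha0. simpl. lra.
    + rewrite char_fun_euler in H by (auto; lra). lra.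
    + destruct (Req_dec w 0) as [->|Hw'].
      * rewrite !PSeries_0 in Hw0. unfold PS_euler in Hw0. rewrite Ha0 in Hw0.
        simpl in Hw0. lra.
      * apply (Hnz w); [lra | apply Hin; lra|].
        rewrite char_fun_euler by (try apply Hin; lra). lra.
Qed.

(** y(z / A(z)) = z for every z in (0, R), so the value is at least R; and y(x) < R for
    every x below the radius. *)
Lemma PS_value_nonvanishing (a y : nat -> R) :
  a 0%nat = 1 ->
  (forall n, 0 <= a n) -> (forall n, 0 <= y n) -> y 0%nat = 0 -> y 1%nat = 1 ->
  (forall m, y m = PS_incr_1 (PS_comp a y) m) ->
  Rbar_lt 0 (CV_radius a) ->
  (forall w : R, 0 < w -> Rbar_lt w (CV_radius a) -> char_fun a w <> 0) ->
  PS_value y (CV_radius y) = CV_radius a.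
Proof.
  intros Ha0 Ha Hyn Hy0 Hy1 Hy HR Hnz.
  pose proof (char_fun_pos_of_nonvanishing a) as Hpos.
  assert (Hpsi : forall z : R, 0 < z -> Rbar_lt z (CV_radius a) ->
    0 < z / PSeries a z /\ Rbar_lt (z / PSeries a z) (CV_radius y) /\
    PSeries y (z / PSeries a z) = z).
  { intros z Hz Hzr. destruct (Rbar_dense _ _ Hzr) as (z' & Hzz & Hzr').
    split; [apply (psi_iteration a y z); auto|].
    apply (value_psi a y z z'); auto.
    apply Hpos; auto; lra. }
  assert (Hxy : forall x : R, 0 < x -> Rbar_lt x (CV_radius y) ->
    x <= PSeries y x /\ Rbar_lt (PSeries y x) (CV_radius a)).
  { intros x Hx Hr. split; [apply value_ge_id; auto; lra|].
    apply (value_fixpoint a y x); auto. }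
  assert (Hr0 : Rbar_lt 0 (CV_radius y)).
  { destruct (Rbar_dense _ _ HR) as (z & Hz & Hzr).
    destruct (Hpsi z Hz Hzr) as (Hx & Hxr & _).
    apply (Rbar_lt_trans 0 (z / PSeries a z)); auto. }
  destruct (CV_radius y) as [s| |] eqn:Er; [| |contradiction].
  - simpl in Hr0. apply PS_value_Finite_lub; [exact Hy0|]. split.
    + (* a partial sum is continuous in x, so its bound by R for x < s extends to s *)
      intros v [N ->]. apply Rbar_not_lt_le. intros Hlt.
      destruct (CV_radius a) as [RR| |] eqn:EA; [|contradiction|contradiction].
      simpl in Hlt.
      set (f := fun x => sum_f_R0 (fun n => y n * x ^ n) N).
      assert (Hf : continuity_pt f s)
        by (apply (continuity_pt_finite_SF (fun n x => y n * x ^ n)); intros; reg).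
      destruct (Hf (f s - RR)) as (d & Hd & Hfd); [unfold f; lra|].
      set (x := Rmax (s / 2) (s - d / 2)).
      assert (Hx : 0 < x < s /\ s - d / 2 <= x).
      { unfold x. pose proof (Rmax_l (s / 2) (s - d / 2)).
        pose proof (Rmax_r (s / 2) (s - d / 2)).
        assert (Rmax (s / 2) (s - d / 2) < s) by (apply Rmax_lub_lt; lra). lra. }
      assert (Hfx : f x <= PSeries y x).
      { apply (sum_nonneg_le_Series (fun n => y n * x ^ n)).
        - intros; apply Rmult_le_pos; auto. apply pow_le; lra.
        - apply ex_series_inside; [lra|]. rewrite Er. simpl; lra. }
      destruct (Hxy x ltac:(lra) (proj2 (proj1 Hx))) as [_ HxR]. simpl in HxR.
      assert (Hdist : Rabs (f x - f s) < f s - RR).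
      { apply (Hfd x). split; [split; [exact I | lra]|].
        simpl. unfold R_dist. rewrite Rabs_left1; lra. }
      apply Rabs_def2 in Hdist. lra.
    + intros b Hub. apply Rbar_le_of_dense; [exact HR|]. intros z Hz Hzr.
      destruct (Hpsi z Hz Hzr) as (Hx & Hxr & HE). rewrite <- HE.
      apply value_le_partial_ub with (s := s); auto.
      * simpl in Hxr; lra.
      * rewrite Er; exact Hxr.
      * intros N. apply Hub. exists N. reflexivity.
  - rewrite PS_value_infinite by exact Hy1.
    destruct (CV_radius a) as [RR| |] eqn:EA; [exfalso|reflexivity|contradiction].
    simpl in HR. destruct (Hxy (RR + 1) ltac:(lra) I) as [H1 H2]. simpl in H2. lra.
Qed.

(** * Elementary inequalities *)

Lemma increment_bound (f df : R -> R) (x y M : R) :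
  (forall t, is_derive f t (df t)) ->
  (forall t, Rmin x y <= t <= Rmax x y -> Rabs (df t) <= M) ->
  Rabs (f y - f x) <= M * Rabs (y - x).
Proof.
  intros Hf HM. destruct (MVT_gen f x y df) as (t & Ht & E).
  - intros; apply Hf.
  - intros t _. apply continuity_pt_filterlim, (ex_derive_continuous f).
    exists (df t); apply Hf.
  - rewrite E, Rabs_mult. apply Rmult_le_compat_r; [apply Rabs_pos|]. auto.
Qed.

Lemma cos_lipschitz (x y : R) : Rabs (cos y - cos x) <= Rabs (y - x).
Proof.
  rewrite <- (Rmult_1_l (Rabs (y - x))).
  apply (increment_bound cos (fun t => - sin t)).
  - intros t. auto_derive; [exact I | ring].
  - intros t _. rewrite Rabs_Ropp. apply Rabs_le. apply SIN_bound.
Qed.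

Lemma sin_lipschitz (x y : R) : Rabs (sin y - sin x) <= Rabs (y - x).
Proof.
  rewrite <- (Rmult_1_l (Rabs (y - x))).
  apply (increment_bound sin cos).
  - intros t. auto_derive; [exact I | ring].
  - intros t _. apply Rabs_le. apply COS_bound.
Qed.

Lemma Rabs_between_0 (x t : R) : Rmin 0 x <= t <= Rmax 0 x -> Rabs t <= Rabs x.
Proof.
  unfold Rmin, Rmax, Rabs. destruct Rle_dec; destruct Rcase_abs; destruct Rcase_abs; lra.
Qed.

Lemma one_minus_cos_sqr (x : R) : 1 - cos x = 2 * (sin (x / 2) * sin (x / 2)).
Proof.
  replace (cos x) with (cos (2 * (x / 2))) by (f_equal; field).
  rewrite cos_2a_sin. ring.
Qed.

Lemma one_minus_cos_bound (x : R) : 0 <= 1 - cos x <= x ^ 2 / 2.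
Proof.
  pose proof (COS_bound x). split; [lra|]. rewrite one_minus_cos_sqr.
  pose proof (sin_lipschitz 0 (x / 2)) as H0.
  rewrite sin_0, !Rminus_0_r in H0. apply Rsqr_le_abs_1 in H0. unfold Rsqr in H0.
  nra.
Qed.

Lemma sin_taylor_bound (x : R) : Rabs (sin x - x) <= Rabs x ^ 3.
Proof.
  pose proof (increment_bound (fun t => sin t - t) (fun t => cos t - 1) 0 x (Rabs x ^ 2)) as H.
  cbv beta in H. rewrite sin_0, !Rminus_0_r in H.
  replace (Rabs x ^ 3) with (Rabs x ^ 2 * Rabs x) by ring.
  apply H.
  - intros t. auto_derive; [exact I | ring].
  - intros t Ht. apply Rabs_between_0 in Ht.
    pose proof (one_minus_cos_bound t) as B. rewrite Rabs_left1 by lra.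
    rewrite <- (pow2_abs t) in B.
    assert (Rabs t ^ 2 <= Rabs x ^ 2) by (apply pow_incr; split; [apply Rabs_pos | exact Ht]).
    pose proof (pow2_ge_0 (Rabs t)). lra.
Qed.

Lemma cos_taylor_bound (x : R) : Rabs (cos x - 1 + x ^ 2 / 2) <= Rabs x ^ 3.
Proof.
  pose proof (Rabs_pos x) as Hx. destruct (Rle_dec (Rabs x) 1) as [H1|H1].
  - pose proof (increment_bound (fun t => cos t - 1 + t ^ 2 / 2) (fun t => - (sin t - t))
      0 x (Rabs x ^ 3)) as H.
    cbv beta in H. rewrite cos_0 in H.
    replace (cos x - 1 + x ^ 2 / 2 - (1 - 1 + 0 ^ 2 / 2)) with (cos x - 1 + x ^ 2 / 2)
      in H by field.
    rewrite Rminus_0_r in H.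
    apply Rle_trans with (Rabs x ^ 3 * Rabs x).
    + apply H.
      * intros t. auto_derive; [exact I | field].
      * intros t Ht. apply Rabs_between_0 in Ht. rewrite Rabs_Ropp.
        eapply Rle_trans; [apply sin_taylor_bound|].
        apply pow_incr. split; [apply Rabs_pos | exact Ht].
    + pose proof (pow_le (Rabs x) 3 Hx). nra.
  - pose proof (one_minus_cos_bound x) as B. rewrite Rabs_pos_eq by lra.
    rewrite <- (pow2_abs x) in *. pose proof (pow_le (Rabs x) 2 Hx).
    replace (Rabs x ^ 3) with (Rabs x ^ 2 * Rabs x) by ring. nra.
Qed.

Lemma one_minus_cos_lower (t : R) : Rabs t <= PI -> t ^ 2 / 18 <= 1 - cos t.
Proof.
  assert (L : forall u, 0 <= u <= PI -> u ^ 2 / 18 <= 1 - cos u).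
  { intros u Hu. rewrite one_minus_cos_sqr.
    pose proof PI_4 as P4. pose proof PI_RGT_0.
    destruct (sin_bound (u / 2) 0) as [B _]; try lra.
    assert (E : sin_approx (u / 2) (2 * 0 + 1) = u / 2 - (u / 2) ^ 3 / 6).
    { unfold sin_approx, sin_term. simpl. field. }
    rewrite E in B. set (v := u / 2) in *.
    assert (Hv : 0 <= v <= 2) by (unfold v; lra).
    assert (Hv3 : v ^ 3 <= 4 * v).
    { replace (v ^ 3) with (v * v * v) by ring. apply Rmult_le_compat_r; [lra|]. apply Rle_trans with (2 * 2); [apply Rmult_le_compat|]; lra. }
    assert (Hs : v / 3 <= sin v) by lra.
    assert (v / 3 * (v / 3) <= sin v * sin v) by (apply Rmult_le_compat; lra).
    replace (u ^ 2 / 18) with (2 * (v / 3 * (v / 3))) by (unfold v; field). lra. }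
  intros Ht. destruct (Rle_dec 0 t) as [H|H].
  - apply L. rewrite Rabs_pos_eq in Ht; lra.
  - rewrite <- cos_neg. replace (t ^ 2) with ((- t) ^ 2) by ring.
    apply L. rewrite Rabs_left in Ht; lra.
Qed.

Lemma exp_neg_taylor_bound (s : R) : 0 <= s -> Rabs (exp (- s) - (1 - s)) <= s ^ 2.
Proof.
  intros Hs. pose proof (exp_ineq1_le (- s)) as L.
  rewrite Rabs_pos_eq by lra.
  assert (U : exp (- s) * (1 + s) <= 1).
  { rewrite exp_Ropp. pose proof (exp_ineq1_le s). pose proof (exp_pos s).
    apply Rmult_le_reg_l with (exp s); [lra|]. rewrite <- Rmult_assoc, Rinv_r by lra. lra. }
  pose proof (exp_pos (- s)).
  apply Rmult_le_reg_r with (1 + s); [lra|].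
  nra.
Qed.

Lemma mul_exp_neg_bound (x : R) : 0 <= x -> x * exp (- x) <= exp (- (x / 2)).
Proof.
  intros Hx. replace (- x) with (- (x / 2) + - (x / 2)) by field. rewrite exp_plus.
  pose proof (exp_pos (- (x / 2))) as H.
  assert (x * exp (- (x / 2)) <= 1); [|nra].
  rewrite exp_Ropp. pose proof (exp_ineq1_le (x / 4)) as H4.
  assert (E : exp (x / 2) = exp (x / 4) * exp (x / 4))
    by (rewrite <- exp_plus; f_equal; field).
  pose proof (exp_pos (x / 2)).
  apply Rmult_le_reg_r with (exp (x / 2)); [assumption|].
  rewrite Rmult_assoc, Rinv_l by lra. rewrite E.
  assert ((1 + x / 4) * (1 + x / 4) <= exp (x / 4) * exp (x / 4))
    by (apply Rmult_le_compat; lra).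
  pose proof (pow2_ge_0 (1 - x / 4)). nra.
Qed.

(** For unit vectors 1 - <a, b> is half the squared distance of a and b, so this is
    |a - b|^2 <= 2 |a - w|^2 + 2 |b - w|^2, with w = (c, s). *)
Lemma unit_vectors_bound (a1 a2 b1 b2 c s : R) :
  a1 ^ 2 + a2 ^ 2 = 1 -> b1 ^ 2 + b2 ^ 2 = 1 -> c ^ 2 + s ^ 2 = 1 ->
  1 - (a1 * b1 + a2 * b2) <=
  2 * (1 - (c * a1 + s * a2)) + 2 * (1 - (c * b1 + s * b2)).
Proof.
  intros Ha Hb Hw.
  pose proof (pow2_ge_0 (a1 + b1 - 2 * c)). pose proof (pow2_ge_0 (a2 + b2 - 2 * s)).
  nra.
Qed.

Lemma cos_sin_1 (x : R) : cos x ^ 2 + sin x ^ 2 = 1.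
Proof. pose proof (sin2_cos2 x). unfold Rsqr in H. lra. Qed.

Lemma one_minus_cos_plus (x y : R) :
  1 - cos (x + y) <= 2 * (1 - cos x) + 2 * (1 - cos y).
Proof.
  pose proof (cos_sin_1 x). pose proof (cos_sin_1 y).
  pose proof (unit_vectors_bound (cos x) (sin x) (cos y) (- sin y) 1 0
    ltac:(lra) ltac:(lra) ltac:(lra)).
  rewrite cos_plus. lra.
Qed.

(** Euclidean descent: a positive m in G that does not divide some n in S leaves a
    smaller positive element n mod m of G. *)
Lemma gcd_1_mem (S G : nat -> Prop) :
  is_set_gcd S 1 -> (forall n, S n -> G n) -> G 0%nat ->
  (forall m n, G m -> G n -> G (m + n)%nat) ->
  (forall m n, G (m + n)%nat -> G n -> G m) ->
  G 1%nat.
Proof.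
  intros [_ Hgcd] HS H0 Hadd Hsub.
  assert (Hmul : forall m q, G m -> G (q * m)%nat).
  { intros m q Hm. induction q as [|q IH]; [exact H0|]. simpl. auto. }
  assert (Hred : forall m, m <> 1%nat -> exists n, S n /\ ~ Nat.divide m n).
  { intros m Hm. apply NNPP. intros Hn. apply Hm.
    apply Nat.divide_1_r, Hgcd. intros n Sn. apply NNPP. intros Hd.
    apply Hn. exists n. auto. }
  assert (Hdesc : forall m, G m -> (0 < m)%nat -> G 1%nat).
  { intros m. induction m as [m IH] using (well_founded_induction Wf_nat.lt_wf).
    intros Gm Hm. destruct (Nat.eq_dec m 1) as [->|Hm1]; [exact Gm|].
    destruct (Hred m Hm1) as (n & Sn & Hn).
    apply (IH (n mod m)%nat).
    - apply Nat.mod_upper_bound; lia.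
    - apply (Hsub _ (n / m * m)%nat); auto.
      replace (n mod m + n / m * m)%nat with n; [auto|].
      rewrite (Nat.div_mod_eq n m) at 1. lia.
    - destruct (n mod m)%nat eqn:E; [|lia].
      exfalso. apply Hn, Nat.Lcm0.mod_divide, E. }
  destruct (Hred 0%nat ltac:(lia)) as (n & Sn & Hn).
  apply (Hdesc n); auto. destruct n; [|lia].
  exfalso. apply Hn. exists 0%nat. reflexivity.
Qed.

(** * Averages against a probability sequence *)

Definition mean (p f : nat -> R) : R := Series (fun k => p k * f k).

Lemma ex_mean_bounded (p f : nat -> R) (M : R) :
  (forall k, 0 <= p k) -> ex_series p -> (forall k, Rabs (f k) <= M) ->
  ex_series (fun k => p k * f k).
Proof.
  intros Hp Hs Hf. apply (ex_series_term_le _ (fun k => M * p k)).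
  - intros k. rewrite Rabs_mult, (Rabs_pos_eq (p k)), Rmult_comm by apply Hp.
    apply Rmult_le_compat_r; auto.
  - exact (ex_series_scal_l M p Hs).
Qed.

Lemma ex_mean_lin (p f g : nat -> R) (a b : R) :
  ex_series (fun k => p k * f k) -> ex_series (fun k => p k * g k) ->
  ex_series (fun k => p k * (a * f k + b * g k)).
Proof.
  intros Hf Hg.
  apply (ex_series_ext (fun k => a * (p k * f k) + b * (p k * g k))).
  - intros k. R_eq; ring.
  - apply (ex_series_plus (fun k => a * (p k * f k)) (fun k => b * (p k * g k))).
    + exact (ex_series_scal_l a _ Hf).
    + exact (ex_series_scal_l b _ Hg).
Qed.

Lemma mean_lin (p f g : nat -> R) (a b : R) :
  ex_series (fun k => p k * f k) -> ex_series (fun k => p k * g k) ->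
  mean p (fun k => a * f k + b * g k) = a * mean p f + b * mean p g.
Proof.
  intros Hf Hg. unfold mean. rewrite <- !Series_scal_l, <- Series_plus.
  - apply Series_ext. intros k. R_eq; ring.
  - exact (ex_series_scal_l a _ Hf).
  - exact (ex_series_scal_l b _ Hg).
Qed.

Lemma mean_ext (p f g : nat -> R) : (forall k, f k = g k) -> mean p f = mean p g.
Proof. intros H. apply Series_ext. intros k. rewrite H. reflexivity. Qed.

Lemma mean_abs_le (p f g : nat -> R) :
  (forall k, 0 <= p k) -> ex_series (fun k => p k * g k) ->
  (forall k, Rabs (f k) <= g k) -> Rabs (mean p f) <= mean p g.
Proof.
  intros Hp Hg H.
  assert (H' : forall k, Rabs (p k * f k) <= p k * g k).
  { intros k. rewrite Rabs_mult, (Rabs_pos_eq (p k)) by apply Hp.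
    apply Rmult_le_compat_l; auto. }
  eapply Rle_trans.
  - apply Series_Rabs. apply (ex_series_term_le _ (fun k => p k * g k)); auto.
    intros k. rewrite Rabs_Rabsolu. auto.
  - apply Series_le; auto. intros k. split; [apply Rabs_pos | auto].
Qed.

(** The partial sums of p (1 + f) and of p (1 - f) both increase, which squeezes the
    tail of p f by that of p. *)
Lemma mean_tail (p f : nat -> R) (N : nat) :
  (forall k, 0 <= p k) -> is_series p 1 -> (forall k, Rabs (f k) <= 1) ->
  Rabs (mean p f - sum_f_R0 (fun k => p k * f k) N) <= 1 - sum_f_R0 p N.
Proof.
  intros Hp Hs Hf.
  assert (Hex : ex_series (fun k => p k * f k))
    by (apply ex_mean_bounded with 1; auto; exists 1; exact Hs).
  assert (Hone : ex_series (fun k => p k * 1))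
    by (apply (ex_series_ext p); [intros; R_eq; ring | exists 1; exact Hs]).
  assert (M1 : mean p (fun _ => 1) = 1).
  { apply is_series_unique. apply (is_series_ext p); [intros; R_eq; ring | exact Hs]. }
  assert (S : forall e, Rabs e <= 1 ->
    sum_f_R0 p N + e * sum_f_R0 (fun k => p k * f k) N <= 1 + e * mean p f).
  { intros e He.
    replace (1 + e * mean p f) with (mean p (fun k => 1 * 1 + e * f k))
      by (rewrite mean_lin by assumption; rewrite M1; ring).
    eapply Rle_trans; [|apply (sum_nonneg_le_Series _ N)].
    - rewrite scal_sum, <- sum_plus. apply Req_le, sum_eq. intros k _. ring.
    - intros k. apply Rmult_le_pos; [apply Hp|].
      assert (Rabs (e * f k) <= 1).
      { rewrite Rabs_mult, <- (Rmult_1_l 1).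
        apply Rmult_le_compat; auto using Rabs_pos. }
      apply Rabs_le_between in H. lra.
    - apply (ex_mean_lin p (fun _ => 1) f 1 e); auto. }
  pose proof (S 1 ltac:(rewrite Rabs_R1; lra)).
  pose proof (S (-1) ltac:(rewrite Rabs_left; lra)).
  apply Rabs_le. lra.
Qed.

Lemma RInt_sum_f_R0 (h : nat -> R -> R) (c : nat -> R) (a b : R) (N : nat) :
  (forall k, ex_RInt (h k) a b) ->
  is_RInt (fun t => sum_f_R0 (fun k => c k * h k t) N) a b
    (sum_f_R0 (fun k => c k * RInt (h k) a b) N).
Proof.
  intros H. induction N as [|N IH].
  - apply (is_RInt_scal (h 0%nat) a b (c 0%nat)).
    exact (RInt_correct (h 0%nat) a b (H 0%nat)).
  - apply (is_RInt_plus (fun t => sum_f_R0 (fun k => c k * h k t) N)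
      (fun t => c (S N) * h (S N) t)); [exact IH|].
    apply (is_RInt_scal (h (S N)) a b (c (S N))).
    exact (RInt_correct (h (S N)) a b (H (S N))).
Qed.

Lemma is_series_RInt_mean (p : nat -> R) (h : nat -> R -> R) (a b : R) :
  a <= b ->
  (forall k, 0 <= p k) -> is_series p 1 ->
  (forall k, ex_RInt (h k) a b) -> (forall k t, Rabs (h k t) <= 1) ->
  ex_RInt (fun t => mean p (fun k => h k t)) a b ->
  is_series (fun k => p k * RInt (h k) a b) (RInt (fun t => mean p (fun k => h k t)) a b).
Proof.
  intros Hab Hp Hs Hh Hb HI. set (I := RInt (fun t => mean p (fun k => h k t)) a b).
  assert (Hd : forall N,
    Rabs (I - sum_f_R0 (fun k => p k * RInt (h k) a b) N) <= (b - a) * (1 - sum_f_R0 p N)).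
  { intros N. pose proof (RInt_sum_f_R0 h p a b N Hh) as HN.
    rewrite <- (is_RInt_unique _ _ _ _ HN).
    replace (I - _) with (RInt (fun t => mean p (fun k => h k t) -
      sum_f_R0 (fun k => p k * h k t) N) a b)
      by (apply (RInt_minus _ _ _ _ HI (ex_intro _ _ HN))).
    apply abs_RInt_le_const; [exact Hab | apply (ex_RInt_minus _ _ _ _ HI (ex_intro _ _ HN))|].
    intros t _. apply mean_tail; auto. }
  assert (Hlim : is_lim_seq (fun N => (b - a) * (1 - sum_f_R0 p N)) 0).
  { replace (Finite 0) with (Finite ((b - a) * (1 - 1))) by (f_equal; ring).
    apply is_lim_seq_mult'; [apply is_lim_seq_const|].
    apply is_lim_seq_minus'; [apply is_lim_seq_const|].
    apply is_lim_seq_ext with (sum_n p); [intros; apply sum_n_Reals | exact Hs]. }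
  apply (is_lim_seq_ext (sum_f_R0 (fun k => p k * RInt (h k) a b))
    (sum_n (fun k => p k * RInt (h k) a b)) I); [intros; symmetry; apply sum_n_Reals|].
  apply is_lim_seq_ext with (fun N => I - (I - sum_f_R0 (fun k => p k * RInt (h k) a b) N));
    [intros; ring|].
  replace (Finite I) with (Finite (I - 0)) by (f_equal; ring).
  apply is_lim_seq_minus'; [apply is_lim_seq_const|].
  apply is_lim_seq_abs_0.
  apply is_lim_seq_le_le with (fun _ => 0) (fun N => (b - a) * (1 - sum_f_R0 p N)).
  - intros N. split; [apply Rabs_pos | apply Hd].
  - apply is_lim_seq_const.
  - exact Hlim.
Qed.

Lemma mean_continuous (p : nat -> R) (h : nat -> R -> R) (t : R) :
  (forall k, 0 <= p k) -> ex_series p -> ex_series (fun k => p k * INR k) ->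
  (forall k s, Rabs (h k s) <= 1) ->
  (forall k s u, Rabs (h k s - h k u) <= INR k * Rabs (s - u)) ->
  continuous (fun s => mean p (fun k => h k s)) t.
Proof.
  intros Hp Hs Hs1 Hb HL. set (L := mean p INR).
  assert (HL0 : 0 <= L).
  { rewrite <- (Rmult_0_l (mean p INR)). unfold L.
    assert (X := mean_abs_le p (fun _ => 0) INR Hp Hs1).
    eapply Rle_trans; [|apply X].
    - rewrite Rmult_0_l. apply Rabs_pos.
    - intros k. rewrite Rabs_R0. apply pos_INR. }
  assert (Hex : forall s, ex_series (fun k => p k * h k s))
    by (intros s; apply ex_mean_bounded with 1; auto).
  assert (Hlip : forall s, Rabs (mean p (fun k => h k s) - mean p (fun k => h k t))
     <= L * Rabs (s - t)).
  { intros s.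
    replace (mean p (fun k => h k s) - mean p (fun k => h k t)) with
      (mean p (fun k => 1 * h k s + -1 * h k t)) by (rewrite mean_lin by auto; ring).
    replace (L * Rabs (s - t)) with (mean p (fun k => Rabs (s - t) * INR k + 0 * INR k))
      by (rewrite mean_lin by auto; unfold L; ring).
    apply mean_abs_le; auto.
    - apply ex_mean_lin; auto.
    - intros k. replace (1 * h k s + -1 * h k t) with (h k s - h k t) by ring.
      rewrite Rmult_0_l, Rplus_0_r, Rmult_comm. apply HL. }
  apply continuity_pt_filterlim. intros e He. exists (e / (L + 1)).
  assert (HL1 : 0 < L + 1) by lra.
  split; [apply Rdiv_lt_0_compat; lra|]. intros s [_ Hst]. simpl in *.
  unfold R_dist in *. eapply Rle_lt_trans; [apply Hlip|].
  apply Rle_lt_trans with ((L + 1) * Rabs (s - t)).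
  - apply Rmult_le_compat_r; [apply Rabs_pos | lra].
  - replace e with ((L + 1) * (e / (L + 1))) by (field; lra).
    apply Rmult_lt_compat_l; assumption.
Qed.

(** * Characteristic functions and their Fourier coefficients *)

Definition expi (x : R) : C := (cos x, sin x).

Lemma expi_plus (x y : R) : expi (x + y) = Cmult (expi x) (expi y).
Proof.
  unfold expi, Cmult. simpl. rewrite cos_plus, sin_plus. f_equal; ring.
Qed.

Lemma expi_0 : expi 0 = RtoC 1.
Proof. unfold expi. rewrite cos_0, sin_0. reflexivity. Qed.

Lemma Cmod_unit (z : C) : Re z ^ 2 + Im z ^ 2 = 1 -> Cmod z = 1.
Proof. intros H. unfold Cmod. rewrite <- sqrt_1. f_equal. exact H. Qed.

Lemma Cmod_expi (x : R) : Cmod (expi x) = 1.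
Proof. apply Cmod_unit. apply cos_sin_1. Qed.

Lemma expi_pow (x : R) (n : nat) : Cpow (expi x) n = expi (INR n * x).
Proof.
  induction n as [|n IH].
  - simpl. rewrite Rmult_0_l, expi_0. reflexivity.
  - rewrite Cpow_S, IH, <- expi_plus, S_INR. f_equal. ring.
Qed.

(** The modulus of z is attained as a scalar product with a unit vector; this replaces
    the choice of an argument of z. *)
Lemma Cmod_eq_projection (z : C) :
  exists c s, c ^ 2 + s ^ 2 = 1 /\ c * Re z + s * Im z = Cmod z.
Proof.
  pose proof (Cmod2_alt z) as H2.
  destruct (Req_dec (Cmod z) 0) as [H0|H0].
  - exists 1, 0. split; [ring|]. apply Cmod_eq_0 in H0. rewrite H0, Cmod_0. simpl. ring.
  - exists (Re z / Cmod z), (Im z / Cmod z). split.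
    + replace ((Re z / Cmod z) ^ 2 + (Im z / Cmod z) ^ 2) with
        ((Re z ^ 2 + Im z ^ 2) / Cmod z ^ 2) by (field; auto).
      rewrite <- H2. field. auto.
    + replace (Re z / Cmod z * Re z + Im z / Cmod z * Im z) with
        ((Re z ^ 2 + Im z ^ 2) / Cmod z) by (field; auto).
      rewrite <- H2. field. auto.
Qed.

Definition charfn (p : nat -> R) (t : R) : C :=
  (mean p (fun k => cos (INR k * t)), mean p (fun k => sin (INR k * t))).

Lemma Rabs_cos_le_1 (x : R) : Rabs (cos x) <= 1.
Proof. apply Rabs_le, COS_bound. Qed.

Lemma Rabs_sin_le_1 (x : R) : Rabs (sin x) <= 1.
Proof. apply Rabs_le, SIN_bound. Qed.

Lemma ex_mean_cos (p f : nat -> R) :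
  (forall k, 0 <= p k) -> ex_series p -> ex_series (fun k => p k * cos (f k)).
Proof. intros. apply ex_mean_bounded with 1; auto using Rabs_cos_le_1. Qed.

Lemma ex_mean_sin (p f : nat -> R) :
  (forall k, 0 <= p k) -> ex_series p -> ex_series (fun k => p k * sin (f k)).
Proof. intros. apply ex_mean_bounded with 1; auto using Rabs_sin_le_1. Qed.

Lemma Re_charfn_mult (p : nat -> R) (t : R) (w : C) :
  (forall k, 0 <= p k) -> ex_series p ->
  Re (Cmult (charfn p t) w) = mean p (fun k => Re (Cmult (expi (INR k * t)) w)).
Proof.
  intros Hp Hs.
  transitivity (mean p (fun k => Re w * cos (INR k * t) + - Im w * sin (INR k * t))).
  - rewrite mean_lin by (apply ex_mean_cos || apply ex_mean_sin; auto).
    unfold charfn, Re, Im, Cmult. simpl. ring.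
  - apply mean_ext. intros k. unfold Re, Im, Cmult, expi. simpl. ring.
Qed.

(** In the direction (c, s) of the characteristic function, the left side is an average of
    nonnegative deficits and the right side is 1 minus its modulus: each atom can be
    bounded separately. *)
Lemma mean_projection_deficit (p : nat -> R) (t c s : R) :
  (forall k, 0 <= p k) -> is_series p 1 ->
  is_series (fun k => p k * (1 - (c * cos (INR k * t) + s * sin (INR k * t))))
    (1 - (c * Re (charfn p t) + s * Im (charfn p t))).
Proof.
  intros Hp Hs. assert (Hex : ex_series p) by (exists 1; exact Hs).
  pose proof (is_series_minus _ _ _ _ Hs (is_series_plus _ _ _ _
    (is_series_scal_l c _ _ (Series_correct _ (ex_mean_cos p (fun k => INR k * t) Hp Hex)))
    (is_series_scal_l s _ _ (Series_correct _ (ex_mean_sin p (fun k => INR k * t) Hp Hex)))))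
    as H.
  eapply is_series_ext; [|exact H]. intros k.
  change (p k + - (c * (p k * cos (INR k * t)) + s * (p k * sin (INR k * t))) =
    p k * (1 - (c * cos (INR k * t) + s * sin (INR k * t)))). ring.
Qed.

Lemma cauchy_schwarz_unit (a b c s : R) :
  a ^ 2 + b ^ 2 = 1 -> c ^ 2 + s ^ 2 = 1 -> c * a + s * b <= 1.
Proof. intros. pose proof (pow2_ge_0 (a - c)). pose proof (pow2_ge_0 (b - s)). nra. Qed.

Lemma Cmod_charfn_le_1 (p : nat -> R) (t : R) :
  (forall k, 0 <= p k) -> is_series p 1 -> Cmod (charfn p t) <= 1.
Proof.
  intros Hp Hs. destruct (Cmod_eq_projection (charfn p t)) as (c & s & Hcs & E).
  pose proof (mean_projection_deficit p t c s Hp Hs) as H. rewrite E in H.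
  assert (0 <= 1 - Cmod (charfn p t)); [|lra].
  apply (is_series_le (fun _ => 0) _ _ _) with (2 := is_series_finite (fun _ => 0) 0 (fun _ _ => eq_refl)) (3 := H).
  intros k. apply Rmult_le_pos; auto.
  pose proof (cauchy_schwarz_unit _ _ c s (cos_sin_1 (INR k * t)) Hcs). lra.
Qed.

(** If 0 and k both carry mass and the modulus is close to 1, then the unit vectors 1 and
    exp(i k t) are both close to the direction of the characteristic function, hence to
    each other. *)
Lemma charfn_deficit_atom (p : nat -> R) (k : nat) :
  (forall k, 0 <= p k) -> is_series p 1 -> 0 < p 0%nat -> (1 <= k)%nat -> 0 < p k ->
  exists D, forall t, 1 - cos (INR k * t) <= D * (1 - Cmod (charfn p t)).
Proof.
  intros Hp Hs H0 Hk Hpk. set (m := Rmin (p 0%nat) (p k)).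
  assert (Hm : 0 < m) by (apply Rmin_glb_lt; auto).
  exists (2 / m). intros t.
  destruct (Cmod_eq_projection (charfn p t)) as (c & s & Hcs & E).
  pose proof (mean_projection_deficit p t c s Hp Hs) as H. rewrite E in H.
  set (u := fun j => p j * (1 - (c * cos (INR j * t) + s * sin (INR j * t)))) in H.
  assert (Hu : forall j, 0 <= u j).
  { intros j. apply Rmult_le_pos; auto.
    pose proof (cauchy_schwarz_unit _ _ c s (cos_sin_1 (INR j * t)) Hcs). lra. }
  assert (Hsum : u 0%nat + u k <= 1 - Cmod (charfn p t)).
  { rewrite <- (is_series_unique _ _ H).
    eapply Rle_trans; [|apply (sum_nonneg_le_Series u k Hu); eexists; exact H].
    destruct k as [|k]; [lia|]. simpl. apply Rplus_le_compat_r.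
    apply (sum_nonneg_incr u 0 k Hu). lia. }
  pose proof (unit_vectors_bound 1 0 (cos (INR k * t)) (sin (INR k * t)) c s
    ltac:(ring) (cos_sin_1 _) Hcs) as B.
  pose proof (cauchy_schwarz_unit 1 0 c s ltac:(ring) Hcs) as B0.
  pose proof (cauchy_schwarz_unit _ _ c s (cos_sin_1 (INR k * t)) Hcs) as B1.
  unfold u in Hsum. simpl (INR 0) in Hsum. rewrite Rmult_0_l, cos_0, sin_0 in Hsum.
  pose proof (Rmin_l (p 0%nat) (p k)) as L0. pose proof (Rmin_r (p 0%nat) (p k)) as L1.
  fold m in L0, L1.
  apply Rmult_le_reg_l with m; [exact Hm|].
  replace (m * (2 / m * (1 - Cmod (charfn p t)))) with (2 * (1 - Cmod (charfn p t)))
    by (field; lra).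
  assert (m * (1 - (c * 1 + s * 0)) <= p 0%nat * (1 - (c * 1 + s * 0)))
    by (apply Rmult_le_compat_r; lra).
  assert (m * (1 - (c * cos (INR k * t) + s * sin (INR k * t))) <=
    p k * (1 - (c * cos (INR k * t) + s * sin (INR k * t))))
    by (apply Rmult_le_compat_r; lra).
  assert (m * (1 - cos (INR k * t)) <= m * (2 * (1 - (c * 1 + s * 0)) +
    2 * (1 - (c * cos (INR k * t) + s * sin (INR k * t)))))
    by (apply Rmult_le_compat_l; lra).
  lra.
Qed.

(** The set of m for which 1 - cos(m t) is at most a constant times the deficit of the
    modulus, uniformly in t, is closed under addition and subtraction. It contains the
    support of p, hence 1 by the gcd hypothesis; and 1 - cos t >= t^2 / 18 on
    [-pi, pi]. So aperiodicity bounds the modulus on the whole interval in one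
    stroke, with no compactness argument away from 0. *)
Lemma Cmod_charfn_gaussian (p : nat -> R) :
  (forall k, 0 <= p k) -> is_series p 1 -> 0 < p 0%nat ->
  is_set_gcd (fun k => (1 <= k)%nat /\ 0 < p k) 1 ->
  exists c, 0 < c /\
    forall t, Rabs t <= PI -> Cmod (charfn p t) <= exp (- (c * t ^ 2)).
Proof.
  intros Hp Hs H0 Hgcd.
  assert (HG : exists D, forall t, 1 - cos (INR 1 * t) <= D * (1 - Cmod (charfn p t))).
  { apply (gcd_1_mem _ (fun m => exists D, forall t,
      1 - cos (INR m * t) <= D * (1 - Cmod (charfn p t))) Hgcd).
    - intros k [Hk Hpk]. apply charfn_deficit_atom; auto.
    - exists 0. intros t. simpl. rewrite Rmult_0_l, cos_0. lra.
    - intros m n [D1 H1] [D2 H2]. exists (2 * D1 + 2 * D2). intros t.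
      rewrite plus_INR, Rmult_plus_distr_r.
      pose proof (one_minus_cos_plus (INR m * t) (INR n * t)).
      specialize (H1 t). specialize (H2 t). lra.
    - intros m n [D1 H1] [D2 H2]. exists (2 * D1 + 2 * D2). intros t.
      replace (INR m * t) with (INR (m + n) * t + - (INR n * t))
        by (rewrite plus_INR; ring).
      pose proof (one_minus_cos_plus (INR (m + n) * t) (- (INR n * t))) as B.
      rewrite (cos_neg (INR n * t)) in B.
      specialize (H1 t). specialize (H2 t). lra. }
  destruct HG as [D HD]. set (D' := Rmax D 1).
  assert (HD1 : 1 <= D') by apply Rmax_r.
  exists (/ (18 * D')). split; [apply Rinv_0_lt_compat; lra|]. intros t Ht.
  pose proof (one_minus_cos_lower t Ht) as L. specialize (HD t).
  simpl (INR 1) in HD. rewrite Rmult_1_l in HD.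
  pose proof (Cmod_charfn_le_1 p t Hp Hs) as M.
  assert (HD' : 1 - cos t <= D' * (1 - Cmod (charfn p t))).
  { eapply Rle_trans; [exact HD|]. apply Rmult_le_compat_r; [lra | apply Rmax_l]. }
  apply Rle_trans with (1 - / (18 * D') * t ^ 2).
  - apply Rmult_le_reg_l with D'; [lra|].
    replace (D' * (1 - / (18 * D') * t ^ 2)) with (D' - t ^ 2 / 18) by (field; lra). lra.
  - pose proof (exp_ineq1_le (- (/ (18 * D') * t ^ 2))). lra.
Qed.

Definition Ccontinuous (f : R -> C) : Prop :=
  forall t, continuous (fun s => Re (f s)) t /\ continuous (fun s => Im (f s)) t.

Lemma Ccontinuous_mult (f g : R -> C) :
  Ccontinuous f -> Ccontinuous g -> Ccontinuous (fun t => Cmult (f t) (g t)).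
Proof.
  intros Hf Hg t. destruct (Hf t) as [Hf1 Hf2]. destruct (Hg t) as [Hg1 Hg2]. split.
  - apply (continuous_minus (fun s => Re (f s) * Re (g s)) (fun s => Im (f s) * Im (g s)));
      apply (continuous_mult (K := R_AbsRing)); assumption.
  - apply (continuous_plus (fun s => Re (f s) * Im (g s)) (fun s => Im (f s) * Re (g s)));
      apply (continuous_mult (K := R_AbsRing)); assumption.
Qed.

Lemma Ccontinuous_pow (f : R -> C) (n : nat) :
  Ccontinuous f -> Ccontinuous (fun t => Cpow (f t) n).
Proof.
  intros Hf. induction n as [|n IH].
  - intros t. split; apply continuous_const.
  - apply (Ccontinuous_mult f (fun t => Cpow (f t) n)); assumption.
Qed.

Lemma Ccontinuous_expi (w : R) : Ccontinuous (fun t => expi (w * t)).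
Proof.
  intros t. split; simpl; apply (ex_derive_continuous (V := R_NormedModule)); auto_derive; exact I.
Qed.

Lemma Ccontinuous_charfn (p : nat -> R) :
  (forall k, 0 <= p k) -> ex_series p -> ex_series (fun k => p k * INR k) ->
  Ccontinuous (charfn p).
Proof.
  intros Hp Hs Hs1 t.
  assert (A : forall k s u, Rabs (INR k * s - INR k * u) = INR k * Rabs (s - u)).
  { intros k s u. rewrite <- Rmult_minus_distr_l, Rabs_mult, (Rabs_pos_eq (INR k));
      auto using pos_INR. }
  split.
  - apply (mean_continuous p (fun k s => cos (INR k * s))); auto using Rabs_cos_le_1.
    intros. rewrite <- A. apply cos_lipschitz.
  - apply (mean_continuous p (fun k s => sin (INR k * s))); auto using Rabs_sin_le_1.
    intros. rewrite <- A. apply sin_lipschitz.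
Qed.

Lemma Ccontinuous_ex_RInt (f : R -> C) (a b : R) :
  Ccontinuous f -> ex_RInt (fun t => Re (f t)) a b.
Proof. intros Hf. apply (ex_RInt_continuous (V := R_CompleteNormedModule)). intros; apply Hf. Qed.

Definition fourier_kernel (p : nat -> R) (n : nat) (j : Z) (t : R) : C :=
  Cmult (Cpow (charfn p t) n) (expi (- IZR j * t)).

Lemma Ccontinuous_fourier_kernel (p : nat -> R) (n : nat) (j : Z) :
  (forall k, 0 <= p k) -> ex_series p -> ex_series (fun k => p k * INR k) ->
  Ccontinuous (fourier_kernel p n j).
Proof.
  intros. apply Ccontinuous_mult; [|apply Ccontinuous_expi].
  apply Ccontinuous_pow, Ccontinuous_charfn; auto.
Qed.

Lemma sin_IZR_PI (j : Z) : sin (IZR j * PI) = 0.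
Proof. apply sin_eq_0_1. exists j. reflexivity. Qed.

Lemma RInt_cos_IZR (j : Z) :
  RInt (fun t => cos (- IZR j * t)) (- PI) PI = if Z.eq_dec j 0 then 2 * PI else 0.
Proof.
  destruct (Z.eq_dec j 0) as [->|Hj].
  - rewrite (RInt_ext _ (fun _ => 1)).
    + rewrite RInt_const. change (scal (PI - - PI) 1) with ((PI - - PI) * 1). R_eq; ring.
    + intros t _. rewrite Ropp_0, Rmult_0_l. apply cos_0.
  - assert (Hj' : IZR j <> 0) by (apply not_0_IZR; exact Hj).
    apply is_RInt_unique.
    pose proof (is_RInt_derive (fun t => sin (IZR j * t) / IZR j)
      (fun t => cos (- IZR j * t)) (- PI) PI) as H.
    replace 0 with (minus (sin (IZR j * PI) / IZR j) (sin (IZR j * - PI) / IZR j)).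
    + apply H.
      * intros t _. auto_derive; [exact I|]. 
        replace (- IZR j * t) with (- (IZR j * t)) by ring. rewrite cos_neg. field. exact Hj'.
      * intros t _. apply (Ccontinuous_expi (- IZR j)).
    + replace (IZR j * - PI) with (- (IZR j * PI)) by ring.
      rewrite sin_neg, sin_IZR_PI. change minus with Rminus. R_eq; field. exact Hj'.
Qed.

(** Induction on the exponent: expanding one factor of P(t)^(n+1) = (sum_k p_k e^(ikt)) P(t)^n
    under the integral is the recursion that defines the coefficients of p^(n+1). *)
Lemma fourier_coefficient (p : nat -> R) (n : nat) (j : Z) :
  (forall k, 0 <= p k) -> is_series p 1 -> ex_series (fun k => p k * INR k) ->
  RInt (fun t => Re (fourier_kernel p n j t)) (- PI) PI =
  2 * PI * (if Z_lt_dec j 0 then 0 else PS_pow p n (Z.to_nat j)).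
Proof.
  intros Hp Hs Hs1. assert (Hex : ex_series p) by (exists 1; exact Hs).
  pose proof PI_RGT_0 as Hpi.
  revert j. induction n as [|n IH]; intros j.
  - rewrite (RInt_ext _ (fun t => cos (- IZR j * t))).
    + rewrite RInt_cos_IZR. destruct (Z.eq_dec j 0) as [->|Hj]; [simpl; R_eq; ring|].
      destruct (Z_lt_dec j 0); [R_eq; ring|]. simpl PS_pow.
      destruct (Z.to_nat j) eqn:E; [lia | simpl; ring].
    + intros t _. unfold fourier_kernel. simpl Cpow. rewrite Cmult_1_l. reflexivity.
  - assert (Hshift : forall t k, Re (Cmult (expi (INR k * t)) (fourier_kernel p n j t)) =
      Re (fourier_kernel p n (j - Z.of_nat k) t)).
    { intros t k. f_equal. unfold fourier_kernel.
      rewrite Cmult_assoc, (Cmult_comm (expi (INR k * t))), <- Cmult_assoc, <- expi_plus.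
      do 2 f_equal. rewrite minus_IZR, <- INR_IZR_INZ. ring. }
    assert (Hrec : forall t, Re (fourier_kernel p (S n) j t) =
      mean p (fun k => Re (fourier_kernel p n (j - Z.of_nat k) t))).
    { intros t. rewrite <- (mean_ext p _ _ (Hshift t)), <- Re_charfn_mult by assumption.
      f_equal. unfold fourier_kernel. rewrite Cpow_S, Cmult_assoc. reflexivity. }
    rewrite (RInt_ext _ (fun t => mean p (fun k =>
      (fun k t => Re (fourier_kernel p n (j - Z.of_nat k) t)) k t)))
      by (intros t _; apply Hrec).
    assert (HS := is_series_RInt_mean p
      (fun k t => Re (fourier_kernel p n (j - Z.of_nat k) t)) (- PI) PI
      ltac:(lra) Hp Hs).
    specialize (HS (fun k => Ccontinuous_ex_RInt _ _ _
      (Ccontinuous_fourier_kernel p n (j - Z.of_nat k) Hp Hex Hs1))).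
    assert (HB : forall k t, Rabs (Re (fourier_kernel p n (j - Z.of_nat k) t)) <= 1).
    { intros k t. eapply Rle_trans; [apply re_le_Cmod|]. unfold fourier_kernel.
      rewrite Cmod_mult, Cmod_pow, Cmod_expi, Rmult_1_r, <- (pow1 n).
      apply pow_incr. split; [apply Cmod_ge_0 | apply Cmod_charfn_le_1; auto]. }
    specialize (HS HB).
    assert (HI : ex_RInt (fun t => mean p (fun k =>
      Re (fourier_kernel p n (j - Z.of_nat k) t))) (- PI) PI).
    { apply (ex_RInt_ext (fun t => Re (fourier_kernel p (S n) j t))).
      - intros t _. apply Hrec.
      - apply (Ccontinuous_ex_RInt (fourier_kernel p (S n) j)).
        apply Ccontinuous_fourier_kernel; auto. }
    specialize (HS HI). cbv beta.
    rewrite <- (is_series_unique _ _ HS).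
    rewrite (Series_ext _ (fun k => 2 * PI * (p k * (if Z_lt_dec (j - Z.of_nat k) 0 then 0
      else PS_pow p n (Z.to_nat (j - Z.of_nat k))))))
      by (intros k; rewrite IH; ring).
    rewrite Series_scal_l. f_equal. apply is_series_unique.
    destruct (Z_lt_dec j 0) as [Hj|Hj].
    + apply (is_series_ext (fun _ => 0));
        [|exact (is_series_finite (fun _ => 0) 0 (fun _ _ => eq_refl))].
      intros k. destruct Z_lt_dec; [R_eq; ring | lia].
    + replace (PS_pow p (S n) (Z.to_nat j)) with
        (sum_f_R0 (fun k => p k * (if Z_lt_dec (j - Z.of_nat k) 0 then 0
          else PS_pow p n (Z.to_nat (j - Z.of_nat k)))) (Z.to_nat j)).
      * apply is_series_finite. intros k Hk. destruct Z_lt_dec; [ring | lia].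
      * simpl PS_pow. apply sum_eq. intros k Hk. destruct Z_lt_dec; [lia|].
        do 2 f_equal. lia.
Qed.

(** * Taylor expansion of the centred characteristic function *)

Lemma Im_charfn_mult (p : nat -> R) (t : R) (w : C) :
  (forall k, 0 <= p k) -> ex_series p ->
  Im (Cmult (charfn p t) w) = mean p (fun k => Im (Cmult (expi (INR k * t)) w)).
Proof.
  intros Hp Hs.
  transitivity (mean p (fun k => Im w * cos (INR k * t) + Re w * sin (INR k * t))).
  - rewrite mean_lin by (apply ex_mean_cos || apply ex_mean_sin; auto).
    unfold charfn, Re, Im, Cmult. simpl. ring.
  - apply mean_ext. intros k. unfold Re, Im, Cmult, expi. simpl. ring.
Qed.

Lemma Cmod_le_Re_Im (z : C) : Cmod z <= Rabs (Re z) + Rabs (Im z).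
Proof.
  pose proof (Rabs_pos (Re z)). pose proof (Rabs_pos (Im z)).
  apply Rsqr_incr_0_var; [|lra]. unfold Rsqr.
  pose proof (Cmod2_alt z) as E. rewrite <- (pow2_abs (Re z)), <- (pow2_abs (Im z)) in E.
  nra.
Qed.

Lemma Cmod_pow_diff (a b : C) (M : R) (n : nat) :
  Cmod a <= M -> Cmod b <= M ->
  Cmod (Cminus (Cpow a (S n)) (Cpow b (S n))) <= INR (S n) * M ^ n * Cmod (Cminus a b).
Proof.
  intros Ha Hb. assert (HM : 0 <= M) by (eapply Rle_trans; [apply Cmod_ge_0 | exact Ha]).
  induction n as [|n IH].
  - rewrite !Cpow_1_r. simpl. lra.
  - replace (Cminus (Cpow a (S (S n))) (Cpow b (S (S n)))) with
      (Cplus (Cmult a (Cminus (Cpow a (S n)) (Cpow b (S n))))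
        (Cmult (Cminus a b) (Cpow b (S n)))) by (rewrite (Cpow_S a (S n)), (Cpow_S b (S n)); ring).
    eapply Rle_trans; [apply Cmod_triangle|]. rewrite !Cmod_mult, Cmod_pow.
    rewrite (S_INR (S n)).
    apply Rle_trans with (M * (INR (S n) * M ^ n * Cmod (Cminus a b)) +
      Cmod (Cminus a b) * M ^ S n).
    + apply Rplus_le_compat.
      * apply Rmult_le_compat; auto using Cmod_ge_0.
      * apply Rmult_le_compat_l; [apply Cmod_ge_0|].
        apply pow_incr. split; [apply Cmod_ge_0 | exact Hb].
    + apply Req_le. simpl pow. ring.
Qed.

(** The characteristic function of X - 1, for X of law p. *)
Definition centered_charfn (p : nat -> R) (t : R) : C := Cmult (charfn p t) (expi (- t)).

(** The variance for mean 1. *)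
Definition variance (p : nat -> R) : R := mean p (fun k => (INR k - 1) ^ 2).

Section Moments.

Variable p : nat -> R.
Hypothesis p_nonneg : forall k, 0 <= p k.
Hypothesis p_mass : is_series p 1.
Hypothesis p_mean : is_series (fun k => p k * INR k) 1.
Hypothesis p_cube : ex_series (fun k => p k * INR k ^ 3).

Lemma ex_mean_cubic (f : nat -> R) :
  (forall k, Rabs (f k) <= 1 * INR k ^ 3 + 1 * 1) -> ex_series (fun k => p k * f k).
Proof.
  intros Hf. apply (ex_series_term_le _ (fun k => p k * (1 * INR k ^ 3 + 1 * 1))).
  - intros k. rewrite Rabs_mult, (Rabs_pos_eq (p k)) by apply p_nonneg.
    apply Rmult_le_compat_l; auto.
  - apply (ex_mean_lin p (fun k => INR k ^ 3) (fun _ => 1)); [exact p_cube|].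
    apply (ex_series_ext p); [intros; R_eq; ring | exists 1; exact p_mass].
Qed.

Lemma ex_mean_const (c : R) : ex_series (fun k => p k * c).
Proof. apply (ex_series_scal_r c p). exists 1. exact p_mass. Qed.

Lemma mean_const (c : R) : mean p (fun _ => c) = c.
Proof.
  unfold mean. rewrite Series_scal_r, (is_series_unique p 1 p_mass). ring.
Qed.

Lemma ex_mean_centered : ex_series (fun k => p k * (INR k - 1)).
Proof.
  apply (ex_series_ext (fun k => p k * (1 * INR k + -1 * 1))); [intros; R_eq; ring|].
  apply (ex_mean_lin p INR (fun _ => 1)); [exists 1; exact p_mean | apply ex_mean_const].
Qed.

Lemma mean_centered : mean p (fun k => INR k - 1) = 0.
Proof.
  rewrite (mean_ext p _ (fun k => 1 * INR k + -1 * 1)) by (intros; ring).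
  rewrite mean_lin; [|exists 1; exact p_mean | apply ex_mean_const].
  rewrite mean_const. unfold mean. rewrite (is_series_unique _ _ p_mean). ring.
Qed.

Lemma INR_cases (k : nat) : INR k = 0 \/ 1 <= INR k.
Proof.
  destruct k as [|k]; [left; reflexivity | right].
  rewrite S_INR. pose proof (pos_INR k). lra.
Qed.

Lemma ex_mean_abs_cube : ex_series (fun k => p k * Rabs (INR k - 1) ^ 3).
Proof.
  apply ex_mean_cubic. intros k. rewrite Rabs_pos_eq by (apply pow_le, Rabs_pos).
  destruct (INR_cases k) as [->|H].
  - rewrite Rabs_left by lra. lra.
  - rewrite Rabs_pos_eq by lra.
    assert ((INR k - 1) ^ 3 <= INR k ^ 3) by (apply pow_incr; lra). lra.
Qed.

Lemma ex_mean_square : ex_series (fun k => p k * (INR k - 1) ^ 2).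
Proof.
  apply ex_mean_cubic. intros k. rewrite Rabs_pos_eq by apply pow2_ge_0.
  destruct (INR_cases k) as [->|H]; [lra|].
  assert ((INR k - 1) ^ 2 <= INR k ^ 2) by (apply pow_incr; lra).
  replace (INR k ^ 3) with (INR k * INR k ^ 2) by ring. nra.
Qed.

Lemma variance_pos : 0 < p 0%nat -> 0 < variance p.
Proof.
  intros H0.
  assert (p 0%nat <= variance p); [|lra].
  eapply Rle_trans; [|apply (sum_nonneg_le_Series (fun k => p k * (INR k - 1) ^ 2) 0)].
  - simpl. lra.
  - intros k. apply Rmult_le_pos; [apply p_nonneg | apply pow2_ge_0].
  - exact ex_mean_square.
Qed.

(** The cubic Taylor estimates of cos and sin at (k - 1) t, averaged over p: the first-order
    term vanishes as the mean is 1, and the third moment controls the remainder. *)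
Lemma centered_charfn_taylor :
  exists K, 0 <= K /\ forall t,
    Cmod (Cminus (centered_charfn p t) (RtoC (1 - variance p * t ^ 2 / 2))) <= K * Rabs t ^ 3.
Proof.
  assert (Hex : ex_series p) by (exists 1; exact p_mass).
  set (M := mean p (fun k => Rabs (INR k - 1) ^ 3)).
  assert (HM : 0 <= M).
  { pose proof (mean_abs_le p (fun _ => 0) _ p_nonneg ex_mean_abs_cube) as H.
    eapply Rle_trans; [apply Rabs_pos|]. apply H.
    intros k. rewrite Rabs_R0. apply pow_le, Rabs_pos. }
  exists (2 * M). split; [lra|]. intros t.
  assert (HE : forall k, Cmult (expi (INR k * t)) (expi (- t)) = expi ((INR k - 1) * t)).
  { intros k. rewrite <- expi_plus. f_equal. ring. }
  assert (Hcube : forall k, Rabs ((INR k - 1) * t) ^ 3 =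
    Rabs t ^ 3 * Rabs (INR k - 1) ^ 3 + 0 * 1).
  { intros k. rewrite Rabs_mult. ring. }
  assert (Hbound : forall f, (forall k, Rabs (f k) <= Rabs ((INR k - 1) * t) ^ 3) ->
    Rabs (mean p f) <= M * Rabs t ^ 3).
  { intros f Hf. eapply Rle_trans; [apply (mean_abs_le p f
      (fun k => Rabs t ^ 3 * Rabs (INR k - 1) ^ 3 + 0 * 1)); auto|].
    - apply (ex_mean_lin p (fun k => Rabs (INR k - 1) ^ 3) (fun _ => 1));
        [apply ex_mean_abs_cube | apply ex_mean_const].
    - intros k. rewrite <- Hcube. apply Hf.
    - rewrite (mean_lin p (fun k => Rabs (INR k - 1) ^ 3) (fun _ => 1));
        [|apply ex_mean_abs_cube | apply ex_mean_const].
      fold M. apply Req_le. ring. }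
  eapply Rle_trans; [apply Cmod_le_Re_Im|].
  replace (2 * M * Rabs t ^ 3) with (M * Rabs t ^ 3 + M * Rabs t ^ 3) by ring.
  apply Rplus_le_compat.
  - replace (Re (Cminus (centered_charfn p t) (RtoC (1 - variance p * t ^ 2 / 2)))) with
      (mean p (fun k => cos ((INR k - 1) * t) - 1 + ((INR k - 1) * t) ^ 2 / 2)).
    + apply Hbound. intros k. apply cos_taylor_bound.
    + transitivity (mean p (fun k => 1 * (1 * cos ((INR k - 1) * t) + -1 * 1) +
        t ^ 2 / 2 * (INR k - 1) ^ 2)); [apply mean_ext; intros; field|].
      rewrite !mean_lin, mean_const; try apply ex_mean_square;
        try apply ex_mean_lin; try apply ex_mean_const;
        try (apply ex_mean_cos; assumption).
      change (Re (Cminus (centered_charfn p t) (RtoC (1 - variance p * t ^ 2 / 2)))) with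
        (Re (centered_charfn p t) - (1 - variance p * t ^ 2 / 2)).
      unfold centered_charfn. rewrite Re_charfn_mult by assumption.
      rewrite (mean_ext p (fun k => Re (Cmult (expi (INR k * t)) (expi (- t))))
        (fun k => cos ((INR k - 1) * t))) by (intros; rewrite HE; reflexivity).
      unfold variance. field.
  - replace (Im (Cminus (centered_charfn p t) (RtoC (1 - variance p * t ^ 2 / 2)))) with
      (mean p (fun k => sin ((INR k - 1) * t) - (INR k - 1) * t)).
    + apply Hbound. intros k. apply sin_taylor_bound.
    + transitivity (mean p (fun k => 1 * sin ((INR k - 1) * t) + - t * (INR k - 1)));
        [apply mean_ext; intros; ring|].
      rewrite mean_lin, mean_centered; [|apply ex_mean_sin; assumption | apply ex_mean_centered].
      change (Im (Cminus (centered_charfn p t) (RtoC (1 - variance p * t ^ 2 / 2)))) with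
        (Im (centered_charfn p t) - 0).
      unfold centered_charfn. rewrite Im_charfn_mult by assumption.
      rewrite (mean_ext p (fun k => Im (Cmult (expi (INR k * t)) (expi (- t))))
        (fun k => sin ((INR k - 1) * t))) by (intros; rewrite HE; reflexivity).
      ring.
Qed.

Lemma centered_charfn_gaussian :
  exists K, 0 <= K /\ forall t, Rabs t <= PI ->
    Cmod (Cminus (centered_charfn p t) (RtoC (exp (- (variance p / 2 * t ^ 2))))) <=
    K * Rabs t ^ 3.
Proof.
  destruct centered_charfn_taylor as (K & HK & H).
  exists (K + variance p ^ 2). pose proof (pow2_ge_0 (variance p)). split; [lra|].
  intros t Ht. set (v := variance p) in *.
  replace (Cminus (centered_charfn p t) (RtoC (exp (- (v / 2 * t ^ 2))))) with
    (Cplus (Cminus (centered_charfn p t) (RtoC (1 - v * t ^ 2 / 2)))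
      (RtoC ((1 - v * t ^ 2 / 2) - exp (- (v / 2 * t ^ 2)))))
    by (rewrite (RtoC_minus _ (exp _)); ring).
  eapply Rle_trans; [apply Cmod_triangle|].
  rewrite Rmult_plus_distr_r. apply Rplus_le_compat; [apply H|].
  assert (Hv : 0 <= v).
  { unfold v, variance. pose proof (mean_abs_le p (fun _ => 0) _ p_nonneg ex_mean_square) as B.
    eapply Rle_trans; [apply Rabs_pos|]. apply B.
    intros k. rewrite Rabs_R0. apply pow2_ge_0. }
  rewrite Cmod_R, Rabs_minus_sym.
  replace (1 - v * t ^ 2 / 2) with (1 - v / 2 * t ^ 2) by field.
  eapply Rle_trans; [apply exp_neg_taylor_bound|].
  - apply Rmult_le_pos; [lra | apply pow2_ge_0].
  - rewrite <- (pow2_abs t). pose proof (Rabs_pos t). pose proof PI_4.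
    pose proof (pow_le (Rabs t) 3 ltac:(assumption)).
    replace ((v / 2 * Rabs t ^ 2) ^ 2) with (v ^ 2 * (Rabs t ^ 3 * (Rabs t / 4))) by field.
    apply Rmult_le_compat_l; [lra|]. rewrite <- (Rmult_1_r (Rabs t ^ 3)) at 2.
    apply Rmult_le_compat_l; lra.
Qed.

End Moments.

(** * Local limit theorem *)

Lemma exp_monotone (x y : R) : x <= y -> exp x <= exp y.
Proof. intros [H| ->]; [apply Rlt_le, exp_increasing, H | lra]. Qed.

Lemma continuous_gauss (b t : R) : continuous (fun t => exp (- (b * t ^ 2))) t.
Proof. apply (ex_derive_continuous (V := R_NormedModule)). auto_derive. exact I. Qed.

Lemma ex_RInt_gauss (b x1 x2 : R) : ex_RInt (fun t => exp (- (b * t ^ 2))) x1 x2.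
Proof.
  apply (ex_RInt_continuous (V := R_CompleteNormedModule)). intros; apply continuous_gauss.
Qed.

Lemma is_RInt_abs_gauss (b x : R) :
  0 < b -> 0 <= x ->
  is_RInt (fun t => Rabs t * exp (- (b * t ^ 2))) (- x) x ((1 - exp (- (b * x ^ 2))) / b).
Proof.
  intros Hb Hx.
  assert (D : forall e t, is_derive (fun t => - e * exp (- (b * t ^ 2)) / (2 * b)) t
    (e * t * exp (- (b * t ^ 2)))).
  { intros e t. auto_derive; [exact I|]. simpl. field. lra. }
  assert (Cn : forall e t, continuous (fun t => e * t * exp (- (b * t ^ 2))) t).
  { intros e t. apply (ex_derive_continuous (V := R_NormedModule)). auto_derive. exact I. }
  assert (H1 : is_RInt (fun t => -1 * t * exp (- (b * t ^ 2))) (- x) 0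
    ((1 - exp (- (b * x ^ 2))) / (2 * b))).
  { replace ((1 - exp (- (b * x ^ 2))) / (2 * b)) with
      (minus (- -1 * exp (- (b * 0 ^ 2)) / (2 * b)) (- -1 * exp (- (b * (- x) ^ 2)) / (2 * b))).
    - apply (is_RInt_derive (fun t => - -1 * exp (- (b * t ^ 2)) / (2 * b))); auto.
    - change minus with Rminus. replace (b * 0 ^ 2) with 0 by ring. rewrite Ropp_0, exp_0.
      replace ((- x) ^ 2) with (x ^ 2) by ring. R_eq; field. lra. }
  assert (H2 : is_RInt (fun t => 1 * t * exp (- (b * t ^ 2))) 0 x
    ((1 - exp (- (b * x ^ 2))) / (2 * b))).
  { replace ((1 - exp (- (b * x ^ 2))) / (2 * b)) with
      (minus (- (1) * exp (- (b * x ^ 2)) / (2 * b)) (- (1) * exp (- (b * 0 ^ 2)) / (2 * b))).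
    - apply (is_RInt_derive (fun t => - (1) * exp (- (b * t ^ 2)) / (2 * b))); auto.
    - change minus with Rminus. replace (b * 0 ^ 2) with 0 by ring. rewrite Ropp_0, exp_0.
      R_eq; field. lra. }
  replace ((1 - exp (- (b * x ^ 2))) / b) with
    (plus ((1 - exp (- (b * x ^ 2))) / (2 * b)) ((1 - exp (- (b * x ^ 2))) / (2 * b)))
    by (change plus with Rplus; R_eq; field; lra).
  apply (is_RInt_Chasles (V := R_NormedModule) _ _ 0).
  - apply is_RInt_ext with (2 := H1). intros t.
    rewrite Rmin_left, Rmax_right by lra. intros Ht. rewrite Rabs_left by lra. R_eq; ring.
  - apply is_RInt_ext with (2 := H2). intros t.
    rewrite Rmin_left, Rmax_right by lra. intros Ht. rewrite Rabs_pos_eq by lra. R_eq; ring.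
Qed.

Lemma RInt_gauss_mono (b x x' : R) :
  0 <= x <= x' ->
  RInt (fun t => exp (- (b * t ^ 2))) (- x) x <= RInt (fun t => exp (- (b * t ^ 2))) (- x') x'.
Proof.
  intros Hx. set (f := fun t => exp (- (b * t ^ 2))).
  assert (P : forall u v, u <= v -> 0 <= RInt f u v).
  { intros u v Huv. apply RInt_ge_0; [exact Huv | apply ex_RInt_gauss|].
    intros; apply Rlt_le, exp_pos. }
  rewrite <- (RInt_Chasles f (- x') (- x) x') by apply ex_RInt_gauss.
  rewrite <- (RInt_Chasles f (- x) x x') by apply ex_RInt_gauss.
  change plus with Rplus.
  pose proof (P (- x') (- x) ltac:(lra)). pose proof (P x x' ltac:(lra)). lra.
Qed.

(** Compare exp(-b t^2) with 1 / (1 + b t^2), whose primitive is an arctangent. *)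
Lemma RInt_gauss_bounded (b x : R) :
  0 < b -> 0 <= x -> RInt (fun t => exp (- (b * t ^ 2))) (- x) x <= PI / sqrt b.
Proof.
  intros Hb Hx. pose proof (sqrt_lt_R0 b Hb) as Hq. pose proof (sqrt_sqrt b ltac:(lra)) as Hqq.
  set (q := sqrt b) in *.
  assert (Hpos : forall t, 0 < 1 + (q * t) ^ 2) by (intros t; pose proof (pow2_ge_0 (q * t)); lra).
  assert (HI : is_RInt (fun t => / (1 + (q * t) ^ 2)) (- x) x
    (minus (atan (q * x) / q) (atan (q * - x) / q))).
  { apply (is_RInt_derive (fun t => atan (q * t) / q)).
    - intros t _.
      replace (/ (1 + (q * t) ^ 2)) with (/ q * (q * / (1 + (q * t) ^ 2)))
        by (field; split; [specialize (Hpos t) |]; lra).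
      apply (is_derive_ext (fun t => / q * atan (q * t))); [intros; unfold Rdiv; R_eq; ring|].
      apply (is_derive_scal (fun t => atan (q * t))).
      apply (is_derive_comp atan (fun t => q * t)).
      + replace (/ (1 + (q * t) ^ 2)) with (/ (1 + (q * t)²)) by (unfold Rsqr; f_equal; ring).
        apply is_derive_atan.
      + auto_derive; [exact I | ring].
    - intros t _. apply (ex_derive_continuous (V := R_NormedModule)). auto_derive.
      specialize (Hpos t). simpl in Hpos. apply Rgt_not_eq; lra. }
  apply Rle_trans with (RInt (fun t => / (1 + (q * t) ^ 2)) (- x) x).
  - apply RInt_le; [lra | apply ex_RInt_gauss | eexists; exact HI|].
    intros t _. rewrite exp_Ropp. apply Rinv_le_contravar; [apply Hpos|].
    replace ((q * t) ^ 2) with (b * t ^ 2) by (rewrite <- Hqq; ring).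
    apply exp_ineq1_le.
  - rewrite (is_RInt_unique _ _ _ _ HI). change minus with Rminus.
    destruct (atan_bound (q * x)) as [_ B1]. destruct (atan_bound (q * - x)) as [B2 _].
    unfold Rdiv. rewrite <- Rmult_minus_distr_r.
    apply Rmult_le_compat_r; [apply Rlt_le, Rinv_0_lt_compat; exact Hq | lra].
Qed.

(** The substitution u = sqrt(n) t turns the left side into the integral of exp(-b u^2)
    over a growing interval, which is increasing and bounded in n. *)
Lemma gauss_scaled_limit (b : R) :
  0 < b -> exists c, 0 < c /\
    is_lim_seq (fun n => sqrt (INR (S n)) *
      RInt (fun t => exp (- (INR (S n) * b * t ^ 2))) (- PI) PI) c.
Proof.
  intros Hb. pose proof PI_RGT_0 as Hpi.
  set (W := fun n => RInt (fun t => exp (- (b * t ^ 2)))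
    (- (sqrt (INR (S n)) * PI)) (sqrt (INR (S n)) * PI)).
  assert (HN : forall n, 0 < INR (S n)) by (intros; apply lt_0_INR; lia).
  assert (Hx : forall n, 0 <= sqrt (INR (S n)) * PI)
    by (intros; apply Rmult_le_pos; [apply sqrt_pos | lra]).
  assert (Hmono : forall n, W n <= W (S n)).
  { intros n. apply RInt_gauss_mono. split; [apply Hx|].
    apply Rmult_le_compat_r; [lra|]. apply sqrt_le_1_alt. apply le_INR. lia. }
  destruct (ex_finite_lim_seq_incr W (PI / sqrt b) Hmono) as [c Hc].
  { intros n. apply RInt_gauss_bounded; auto. }
  exists c. split.
  - apply Rlt_le_trans with (W 0%nat).
    + apply RInt_gt_0.
      * simpl. rewrite sqrt_1. lra.
      * intros; apply exp_pos.
      * intros; apply continuous_gauss.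
    + apply (is_lim_seq_incr_compare W c Hc Hmono).
  - apply (is_lim_seq_ext W); [|exact Hc]. intros n. unfold W.
    set (q := sqrt (INR (S n))).
    pose proof (RInt_comp_lin (fun t => exp (- (b * t ^ 2))) q 0 (- PI) PI) as H.
    rewrite !Rplus_0_r in H. rewrite Ropp_mult_distr_r. rewrite <- H by apply ex_RInt_gauss.
    rewrite (RInt_ext _ (fun t => scal q (exp (- (INR (S n) * b * t ^ 2))))).
    + rewrite (RInt_scal (V := R_CompleteNormedModule)) by apply ex_RInt_gauss. reflexivity.
    + intros t _. do 3 f_equal. rewrite Rplus_0_r.
      replace (INR (S n)) with (q * q) by (apply sqrt_sqrt, Rlt_le, HN). ring.
Qed.

Lemma is_lim_seq_inv_sqrt : is_lim_seq (fun n => / sqrt (INR (S n))) 0.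
Proof.
  apply is_lim_seq_ext with (fun n => sqrt (/ INR (S n))).
  - intros n. apply sqrt_inv.
  - rewrite <- sqrt_0. apply (is_lim_seq_continuous sqrt).
    + apply continuity_pt_sqrt. lra.
    + apply (is_lim_seq_incr_1 (fun n => / INR n)).
      apply (is_lim_seq_inv _ p_infty is_lim_seq_INR). discriminate.
Qed.

Section LocalLimit.

Variable p : nat -> R.
Hypothesis p_nonneg : forall k, 0 <= p k.
Hypothesis p_mass : is_series p 1.
Hypothesis p_mean : is_series (fun k => p k * INR k) 1.
Hypothesis p_cube : ex_series (fun k => p k * INR k ^ 3).
Hypothesis p_zero : 0 < p 0%nat.
Hypothesis p_gcd : is_set_gcd (fun k => (1 <= k)%nat /\ 0 < p k) 1.

Lemma fourier_kernel_centered (n : nat) (t : R) :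
  fourier_kernel p (S n) (Z.of_nat n) t =
  Cmult (Cpow (centered_charfn p t) (S n)) (expi t).
Proof.
  unfold fourier_kernel, centered_charfn.
  rewrite Cpow_mult_l, expi_pow, <- Cmult_assoc, <- expi_plus. do 2 f_equal.
  rewrite <- INR_IZR_INZ, S_INR. ring.
Qed.

Lemma Cmod_centered_charfn (t : R) : Cmod (centered_charfn p t) = Cmod (charfn p t).
Proof. unfold centered_charfn. rewrite Cmod_mult, Cmod_expi. ring. Qed.

Lemma Cmod_expi_minus_1 (t : R) : Cmod (Cminus (expi t) (RtoC 1)) <= 2 * Rabs t.
Proof.
  eapply Rle_trans; [apply Cmod_le_Re_Im|].
  pose proof (cos_lipschitz 0 t) as H1. pose proof (sin_lipschitz 0 t) as H2.
  rewrite cos_0 in H1. rewrite sin_0 in H2.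
  replace (t - 0) with t in H1, H2 by ring.
  change (Re (Cminus (expi t) (RtoC 1))) with (cos t - 1).
  change (Im (Cminus (expi t) (RtoC 1))) with (sin t - 0). lra.
Qed.

Lemma exp_neg_pow (x : R) (n : nat) : exp (- x) ^ n = exp (- (INR n * x)).
Proof.
  induction n as [|n IH].
  - simpl. rewrite Rmult_0_l, Ropp_0, exp_0. reflexivity.
  - simpl pow. rewrite IH, <- exp_plus, S_INR. f_equal. ring.
Qed.

(** Both phi and the Gaussian g of the same variance are bounded by exp(-c t^2) and differ
    by O(|t|^3), so their n-th powers differ by n |t|^3 exp(-c n t^2) up to a constant.
    As x exp(-x) <= exp(-x / 2), the factor n t^2 is absorbed at the price of halving c,
    and what is left integrates to O(1/n). *)
Lemma fourier_kernel_gaussian :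
  exists c L, 0 < c /\ 0 <= L /\ forall n t, Rabs t <= PI ->
    Rabs (Re (fourier_kernel p (S n) (Z.of_nat n) t) -
      exp (- (INR (S n) * (variance p / 2) * t ^ 2))) <=
    L * (Rabs t * exp (- (INR (S n) * c * t ^ 2))).
Proof.
  destruct (centered_charfn_gaussian p p_nonneg p_mass p_mean p_cube) as (K & HK & HT).
  destruct (Cmod_charfn_gaussian p p_nonneg p_mass p_zero p_gcd) as (c0 & Hc0 & HG).
  pose proof (variance_pos p p_nonneg p_mass p_cube p_zero) as Hv.
  set (v := variance p) in *. set (c := Rmin c0 (v / 2)).
  assert (Hc : 0 < c) by (apply Rmin_glb_lt; lra).
  assert (Hcc : c <= c0) by apply Rmin_l. assert (Hcv : c <= v / 2) by apply Rmin_r.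
  exists (c / 2), (exp (c * PI ^ 2) * K / c + 2).
  pose proof (exp_pos (c * PI ^ 2)) as Hep.
  assert (HA : 0 <= exp (c * PI ^ 2) * K / c)
    by (apply Rmult_le_pos; [apply Rmult_le_pos; lra | apply Rlt_le, Rinv_0_lt_compat; lra]).
  split; [lra|]. split; [lra|]. intros n t Ht.
  set (N := INR (S n)). assert (HN : 0 < N) by (apply lt_0_INR; lia).
  set (phi := centered_charfn p t). set (g := RtoC (exp (- (v / 2 * t ^ 2)))).
  pose proof (Rabs_pos t) as Ht0. pose proof (pow2_ge_0 t) as Ht2.
  assert (Hphi : Cmod phi <= exp (- (c * t ^ 2))).
  { unfold phi. rewrite Cmod_centered_charfn. eapply Rle_trans; [apply HG, Ht|].
    apply exp_monotone. apply Ropp_le_contravar, Rmult_le_compat_r; auto. }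
  assert (Hg : Cmod g <= exp (- (c * t ^ 2))).
  { unfold g. rewrite Cmod_R, Rabs_pos_eq by apply Rlt_le, exp_pos.
    apply exp_monotone. apply Ropp_le_contravar, Rmult_le_compat_r; auto. }
  assert (HgN : Cpow g (S n) = RtoC (exp (- (N * (v / 2) * t ^ 2)))).
  { unfold g. rewrite <- RtoC_pow, exp_neg_pow. do 3 f_equal. unfold N. ring. }
  set (E2 := exp (- (N * (c / 2) * t ^ 2))).
  set (E1 := exp (- (N * c * t ^ 2))).
  assert (HE12 : E1 <= E2).
  { apply exp_monotone. apply Ropp_le_contravar, Rmult_le_compat_r; auto.
    apply Rmult_le_compat_l; lra. }
  assert (HE1 : 0 < E1) by apply exp_pos.
  assert (Hsplit : Re (fourier_kernel p (S n) (Z.of_nat n) t) -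
      exp (- (N * (v / 2) * t ^ 2)) =
    Re (Cplus (Cmult (Cminus (Cpow phi (S n)) (Cpow g (S n))) (expi t))
      (Cmult (Cpow g (S n)) (Cminus (expi t) (RtoC 1))))).
  { rewrite fourier_kernel_centered. fold phi.
    transitivity (Re (Cminus (Cmult (Cpow phi (S n)) (expi t)) (Cpow g (S n)))).
    - rewrite HgN. reflexivity.
    - f_equal. ring. }
  rewrite Hsplit. eapply Rle_trans; [apply re_le_Cmod|].
  eapply Rle_trans; [apply Cmod_triangle|].
  rewrite !Cmod_mult, Cmod_expi, Rmult_1_r, Rmult_plus_distr_r.
  apply Rplus_le_compat.
  - eapply Rle_trans; [apply (Cmod_pow_diff phi g _ n Hphi Hg)|]. fold N.
    (* exp (- c t^2)^n loses one factor against exp (- c t^2)^(n+1), at most exp (c PI^2) *)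
    assert (Hn : exp (- (c * t ^ 2)) ^ n <= exp (c * PI ^ 2) * E1).
    { rewrite exp_neg_pow. unfold E1. rewrite <- exp_plus. apply exp_monotone.
      assert (t ^ 2 <= PI ^ 2) by (rewrite <- (pow2_abs t); apply pow_incr; lra).
      assert (c * t ^ 2 <= c * PI ^ 2) by (apply Rmult_le_compat_l; lra).
      unfold N. rewrite S_INR. lra. }
    apply Rle_trans with (N * (exp (c * PI ^ 2) * E1) * (K * Rabs t ^ 3)).
    + apply Rmult_le_compat; [|apply Cmod_ge_0| |apply HT, Ht].
      * apply Rmult_le_pos; [lra | apply pow_le, Rlt_le, exp_pos].
      * apply Rmult_le_compat_l; [lra | exact Hn].
    + assert (HX : N * c * t ^ 2 * E1 <= E2).
      { unfold E1, E2. replace (N * (c / 2) * t ^ 2) with (N * c * t ^ 2 / 2) by field.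
        apply mul_exp_neg_bound. apply Rmult_le_pos; [apply Rmult_le_pos; lra | exact Ht2]. }
      replace (Rabs t ^ 3) with (Rabs t * t ^ 2) by (rewrite <- (pow2_abs t); ring).
      replace (N * (exp (c * PI ^ 2) * E1) * (K * (Rabs t * t ^ 2))) with
        (exp (c * PI ^ 2) * K / c * (Rabs t * (N * c * t ^ 2 * E1))) by (field; lra).
      apply Rmult_le_compat_l; [exact HA|]. apply Rmult_le_compat_l; assumption.
  - rewrite HgN, Cmod_R, Rabs_pos_eq by apply Rlt_le, exp_pos.
    replace (2 * (Rabs t * E2)) with (E2 * (2 * Rabs t)) by ring.
    apply Rmult_le_compat; [apply Rlt_le, exp_pos | apply Cmod_ge_0 | | apply Cmod_expi_minus_1].
    apply exp_monotone. apply Ropp_le_contravar, Rmult_le_compat_r; auto.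
    apply Rmult_le_compat_l; lra.
Qed.

(** By Fourier inversion [u^n] p(u)^(n+1) is 1 / (2 pi) times an integral over [-pi, pi],
    within O(1/n) of the Gaussian integral; the latter, times sqrt(n), tends to a
    positive limit. *)
Theorem local_limit :
  exists c, 0 < c /\ is_lim_seq (fun n => sqrt (INR (S n)) * PS_pow p (S n) n) c.
Proof.
  pose proof PI_RGT_0 as Hpi.
  destruct fourier_kernel_gaussian as (c & L & Hc & HL & HF).
  pose proof (variance_pos p p_nonneg p_mass p_cube p_zero) as Hv.
  destruct (gauss_scaled_limit (variance p / 2) ltac:(lra)) as (d & Hd & HW).
  set (G := fun n => RInt (fun t => exp (- (INR (S n) * (variance p / 2) * t ^ 2))) (- PI) PI)
    in HW.
  set (J := fun n => RInt (fun t => Re (fourier_kernel p (S n) (Z.of_nat n) t)) (- PI) PI).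
  assert (Hex1 : ex_series (fun k => p k * INR k)) by (exists 1; exact p_mean).
  assert (HJ : forall n, J n = 2 * PI * PS_pow p (S n) n).
  { intros n. unfold J. rewrite fourier_coefficient by assumption.
    destruct Z_lt_dec; [lia|]. rewrite Nat2Z.id. reflexivity. }
  assert (Hdiff : forall n, Rabs (J n - G n) <= L / (INR (S n) * c)).
  { intros n. assert (HN : 0 < INR (S n)) by (apply lt_0_INR; lia).
    assert (Hb : 0 < INR (S n) * c) by (apply Rmult_lt_0_compat; lra).
    pose proof (Ccontinuous_ex_RInt _ (- PI) PI (Ccontinuous_fourier_kernel p (S n)
      (Z.of_nat n) p_nonneg (ex_intro _ _ p_mass) Hex1)) as E1.
    pose proof (ex_RInt_gauss (INR (S n) * (variance p / 2)) (- PI) PI) as E2.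
    pose proof (is_RInt_scal _ _ _ L _
      (is_RInt_abs_gauss (INR (S n) * c) PI Hb ltac:(lra))) as E3.
    unfold J, G. 
    replace (RInt _ (- PI) PI - RInt _ (- PI) PI) with
      (RInt (fun t => Re (fourier_kernel p (S n) (Z.of_nat n) t) -
        exp (- (INR (S n) * (variance p / 2) * t ^ 2))) (- PI) PI)
      by (apply (RInt_minus _ _ _ _ E1 E2)).
    eapply Rle_trans; [apply abs_RInt_le; [lra | apply (ex_RInt_minus _ _ _ _ E1 E2)]|].
    apply Rle_trans with (L * ((1 - exp (- (INR (S n) * c * PI ^ 2))) / (INR (S n) * c))).
    - pose proof (is_RInt_unique _ _ _ _ E3) as V.
      change (RInt (fun t => L * (Rabs t * exp (- (INR (S n) * c * t ^ 2)))) (- PI) PI =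
        L * ((1 - exp (- (INR (S n) * c * PI ^ 2))) / (INR (S n) * c))) in V.
      rewrite <- V.
      apply RInt_le; [lra | | eexists; exact E3|].
      + apply (ex_RInt_norm _ _ _ (ex_RInt_minus _ _ _ _ E1 E2)).
      + intros t Ht. apply HF. apply Rabs_le. lra.
    - unfold Rdiv at 2. apply Rmult_le_compat_l; [exact HL|].
      rewrite <- (Rmult_1_l (/ (INR (S n) * c))).
      apply Rmult_le_compat_r; [apply Rlt_le, Rinv_0_lt_compat; exact Hb|].
      pose proof (exp_pos (- (INR (S n) * c * PI ^ 2))). lra. }
  assert (Hlim : is_lim_seq (fun n => sqrt (INR (S n)) * (J n - G n)) 0).
  { apply is_lim_seq_abs_0.
    apply is_lim_seq_le_le with (fun _ => 0) (fun n => L / c * / sqrt (INR (S n))).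
    - intros n. split; [apply Rabs_pos|].
      assert (HN : 0 < INR (S n)) by (apply lt_0_INR; lia).
      pose proof (sqrt_lt_R0 _ HN) as Hq. pose proof (sqrt_sqrt _ (Rlt_le _ _ HN)) as Hqq.
      rewrite Rabs_mult, Rabs_pos_eq by lra.
      replace (L / c * / sqrt (INR (S n))) with
        (sqrt (INR (S n)) * (L / (sqrt (INR (S n)) * sqrt (INR (S n)) * c))) by (field; lra).
      rewrite Hqq. apply Rmult_le_compat_l; [lra | apply Hdiff].
    - apply is_lim_seq_const.
    - replace (Finite 0) with (Finite (L / c * 0)) by (f_equal; ring).
      apply is_lim_seq_mult'; [apply is_lim_seq_const | apply is_lim_seq_inv_sqrt]. }
  exists (d / (2 * PI)). split; [apply Rdiv_lt_0_compat; lra|].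
  apply is_lim_seq_ext with (fun n => (sqrt (INR (S n)) * (J n - G n) +
    sqrt (INR (S n)) * G n) * / (2 * PI)).
  - intros n. rewrite (HJ n). field. lra.
  - replace (Finite (d / (2 * PI))) with (Finite ((0 + d) * / (2 * PI)))
      by (f_equal; unfold Rdiv; ring).
    apply is_lim_seq_mult'; [|apply is_lim_seq_const].
    apply is_lim_seq_plus'; assumption.
Qed.

End LocalLimit.

(** * Coefficient asymptotics and the dichotomy *)

Lemma Rpower_neg_three_halves (x : R) :
  0 < x -> Rpower x (- (3 / 2)) = / (x * sqrt x).
Proof.
  intros Hx. rewrite Rpower_Ropp. f_equal.
  replace (3 / 2) with (1 + / 2) by field.
  rewrite Rpower_plus, Rpower_1, Rpower_sqrt by assumption. reflexivity.
Qed.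

(** p_n = a_n z0^n / A(z0) is a probability sequence, and its mean z0 A'(z0) / A(z0) is 1
    exactly because z0 is a zero of A(z) - z A'(z). Since z0 < R, all its moments are
    finite. *)
Lemma tilted_local_limit (a : nat -> R) (z0 : R) :
  a 0%nat = 1 -> (forall n, 0 <= a n) -> 0 < z0 -> Rbar_lt z0 (CV_radius a) ->
  char_fun a z0 = 0 -> is_set_gcd (fun n => (1 <= n)%nat /\ 0 < a n) 1 ->
  exists c, 0 < c /\
    is_lim_seq (fun n => sqrt (INR (S n)) *
      (PS_pow a (S n) n * z0 ^ n * (/ PSeries a z0) ^ S n)) c.
Proof.
  intros Ha0 Ha Hz Hr Hc Hgcd.
  rewrite char_fun_euler in Hc by (auto; lra).
  pose proof (PSeries_ge_1 a z0 Ha0 Ha ltac:(lra) Hr) as HA.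
  set (A := PSeries a z0) in *.
  assert (HAi : 0 < / A) by (apply Rinv_0_lt_compat; lra).
  set (p := fun n => a n * z0 ^ n * / A).
  assert (Hp : forall n, 0 <= p n).
  { intros n. apply Rmult_le_pos; [apply Rmult_le_pos; auto; apply pow_le|]; lra. }
  assert (Hmass : is_series p 1).
  { replace 1 with (/ A * A) by (field; lra).
    apply (is_series_ext (fun n => / A * (a n * z0 ^ n))); [intros; unfold p; R_eq; ring|].
    apply (is_series_scal_l (/ A) (fun n => a n * z0 ^ n)).
    apply is_series_PSeries; [lra | exact Hr]. }
  assert (Hr1 : Rbar_lt z0 (CV_radius (PS_euler a))) by (rewrite CV_radius_euler; exact Hr).
  assert (Hmean : is_series (fun n => p n * INR n) 1).
  { replace 1 with (/ A * PSeries (PS_euler a) z0)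
      by (replace (PSeries (PS_euler a) z0) with A by lra; field; lra).
    apply (is_series_ext (fun n => / A * (PS_euler a n * z0 ^ n)));
      [intros; unfold p, PS_euler; R_eq; ring|].
    apply (is_series_scal_l (/ A) (fun n => PS_euler a n * z0 ^ n)).
    apply is_series_PSeries; [lra | exact Hr1]. }
  assert (Hcube : ex_series (fun n => p n * INR n ^ 3)).
  { apply (ex_series_ext (fun n => / A * (PS_euler (PS_euler (PS_euler a)) n * z0 ^ n)));
      [intros; unfold p, PS_euler; R_eq; ring|].
    apply (ex_series_scal_l (/ A) (fun n => PS_euler (PS_euler (PS_euler a)) n * z0 ^ n)).
    apply ex_series_inside; [lra|]. rewrite !CV_radius_euler. exact Hr. }
  assert (Hpos : forall n, 0 < p n <-> 0 < a n).
  { intros n. pose proof (pow_lt z0 n Hz). unfold p. split; intros H0.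
    - destruct (Ha n) as [Hn|Hn]; [exact Hn|]. rewrite <- Hn in H0. lra.
    - apply Rmult_lt_0_compat; [apply Rmult_lt_0_compat|]; assumption. }
  destruct (local_limit p Hp Hmass Hmean Hcube) as (c & Hcpos & Hlim).
  - apply Hpos. lra.
  - destruct Hgcd as [Hg1 Hg2]. split; [intros; apply Nat.divide_1_l|].
    intros d Hd. apply Hg2. intros n [Hn Han]. apply Hd. split; [exact Hn | apply Hpos, Han].
  - exists c. split; [exact Hcpos|].
    apply (is_lim_seq_ext (fun n => sqrt (INR (S n)) * PS_pow p (S n) n)); [|exact Hlim].
    intros n. unfold p. rewrite PS_pow_dilate. reflexivity.
Qed.

(** By Lagrange inversion (n+1) y_(n+1) = [u^n] A^(n+1), which is a known multiple of
    (A(z0) / z0)^(n+1) times the coefficient of the local limit theorem. *)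
Lemma coefficient_asymptotics (a y : nat -> R) (z0 : R) :
  a 0%nat = 1 -> (forall n, 0 <= a n) -> y 0%nat = 0 ->
  (forall m, y m = PS_incr_1 (PS_comp a y) m) ->
  0 < z0 -> Rbar_lt z0 (CV_radius a) ->
  char_fun a z0 = 0 -> is_set_gcd (fun n => (1 <= n)%nat /\ 0 < a n) 1 ->
  exists (C : R) (eps : nat -> R), 0 < C /\ is_lim_seq eps (Finite 0) /\
    forall n : nat, (1 <= n)%nat ->
      y n = C * / ((z0 / PSeries a z0) ^ n) * Rpower (INR n) (- (3 / 2)) * (1 + eps n).
Proof.
  intros Ha0 Ha Hy0 Hy Hz Hr Hc Hgcd.
  destruct (tilted_local_limit a z0 Ha0 Ha Hz Hr Hc Hgcd) as (c & Hcpos & Hlim).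
  pose proof (PSeries_ge_1 a z0 Ha0 Ha ltac:(lra) Hr) as HA.
  set (A := PSeries a z0) in *. set (s := z0 / A).
  assert (Hs : 0 < s) by (apply Rdiv_lt_0_compat; lra).
  set (w := fun n => sqrt (INR (S n)) * (PS_pow a (S n) n * z0 ^ n * (/ A) ^ S n)) in Hlim.
  exists (z0 * c), (fun n => w (pred n) / c - 1).
  split; [apply Rmult_lt_0_compat; assumption|]. split.
  - apply is_lim_seq_incr_1. simpl pred.
    replace (Finite 0) with (Finite (c * / c - 1)) by (f_equal; field; lra).
    apply is_lim_seq_minus'; [|apply is_lim_seq_const].
    apply is_lim_seq_mult'; [exact Hlim | apply is_lim_seq_const].
  - intros [|n] Hn; [lia|]. simpl pred.
    assert (HN : 0 < INR (S n)) by (apply lt_0_INR; lia).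
    pose proof (sqrt_lt_R0 _ HN) as Hq.
    rewrite Rpower_neg_three_halves by exact HN.
    apply Rmult_eq_reg_l with (INR (S n)); [|lra].
    rewrite (lagrange_inversion_1 a y n Hy0 Hy). unfold w, s, Rdiv.
    rewrite Rpow_mult_distr, !pow_inv. simpl (z0 ^ S n).
    field. repeat split; try lra; try (apply pow_nonzero; lra).
Qed.

Theorem theorem2p6 (a y : nat -> R) (RA r : Rbar)
    (ha0 : a 0%nat = 1)
    (hy0 : y 0%nat = 0)
    (hRA : CV_radius a = RA)
    (hr : CV_radius y = r)
    (hRA_pos : Rbar_lt (Finite 0) RA)
    (ha_nonneg : forall n : nat, (1 <= n)%nat -> 0 <= a n)
    (hy_eq : forall n : nat, y n = PS_incr_1 (PS_comp a y) n)
    (hgcd : is_set_gcd (fun n : nat => (1 <= n)%nat /\ 0 < a n) 1) :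
  let case1 :=
    (forall z : R, 0 < z -> Rbar_lt (Finite z) RA -> char_fun a z <> 0) /\
    PS_value y r = RA in
  let case2 :=
    exists z0 s : R,
      PS_value y r = Finite z0 /\
      r = Finite s /\
      char_fun a z0 = 0 /\
      Rbar_lt (Finite z0) RA /\
      unique (fun z : R =>
        0 < z /\ Rbar_lt (Finite z) RA /\ char_fun a z = 0) z0 /\
      (exists (C : R) (eps : nat -> R),
        0 < C /\
        is_lim_seq eps (Finite 0) /\
        forall n : nat, (1 <= n)%nat ->
          y n = C * / (s ^ n) * Rpower (INR n) (- (3 / 2)) * (1 + eps n)) in
  (case1 \/ case2) /\ ~ (case1 /\ case2).
Proof.
  intros case1 case2. subst RA r.
  assert (ha : forall n, 0 <= a n).
  { intros [|n]; [rewrite ha0; lra | apply ha_nonneg; lia]. }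
  pose proof (fixpoint_coef_nonneg a y ha hy0 hy_eq) as hy.
  assert (hy1 : y 1%nat = 1) by (rewrite (fixpoint_coef_1 a y hy_eq); exact ha0).
  split.
  - destruct (classic (exists z0 : R,
      0 < z0 /\ Rbar_lt z0 (CV_radius a) /\ char_fun a z0 = 0)) as [(z0 & Hz & Hr & Hc)|Hnz].
    + right. exists z0, (z0 / PSeries a z0).
      pose proof (radius_at_zero a y z0 ha0 ha hy hy0 hy1 hy_eq Hz Hr Hc) as Hrad.
      split; [rewrite Hrad; apply PS_value_at_zero; auto|].
      split; [exact Hrad|]. split; [exact Hc|]. split; [exact Hr|]. split.
      * split; [auto|]. intros w (Hw & Hwr & Hwc). apply (char_fun_zero_unique a); auto.
      * apply coefficient_asymptotics; auto.
    + left.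
      assert (Hnv : forall z : R, 0 < z -> Rbar_lt z (CV_radius a) -> char_fun a z <> 0)
        by (intros z Hz Hr Hc; apply Hnz; exists z; auto).
      split; [exact Hnv | apply PS_value_nonvanishing; auto].
  - intros [[_ H1] (z0 & s & H2 & _ & _ & Hlt & _)].
    rewrite H2 in H1. rewrite <- H1 in Hlt. simpl in Hlt. lra.
Qed.
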